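(* Let $n\ge 3$ be an integer and let $z_0\in\mathbb{B}^{n+1}$. Define $\omega_0=\frac{z_0}{|z_0|^2}\left(1-\sqrt{1-|z_0|^2}\right)\in\mathbb{B}^{n+1}$ (with $\omega_0=0$ if $z_0=0$). (1) Suppose $n=3$, let $f(\xi)=-\log|1-\langle z_0,\xi\rangle|$ for $\xi\in\mathbb{S}^3$, and let $v$, smooth on $\overline{\mathbb{B}^4}$, be a solution of $$\Delta^2 v=0\ \text{ in }\mathbb{B}^4,\qquad \eta v=0\ \text{ on }\mathbb{S}^3,\qquad v=f\ \text{ on }\mathbb{S}^3.$$ Then $$v(\xi)=-\log F(\xi,\omega_0)^2+\frac{1-|\xi|^2}{2}\left[\frac{1-|\omega_0|^2}{F(\xi,\omega_0)^2}-1\right]+\log(1+|\omega_0|^2).$$ (2) Suppose $n>3$, let $f(\xi)=|1-\langle z_0,\xi\rangle|^{(3-n)/2}$ for $\xi\in\mathbb{S}^n$, and let $v$, smooth on $\overline{\mathbb{B}^{n+1}}$, be a solution of $$\Delta^2 v=0\ \text{ in }\mathbb{B}^{n+1},\qquad \eta v=-\frac{n-3}{2}v\ \text{ on }\mathbb{S}^n,\qquad v=f\ \text{ on }\mathbb{S}^n.$$ Then $$v(\xi)=\frac{(1+|\omega_0|^2)^{\frac{n-3}{2}}}{F(\xi,\omega_0)^{n-3}}\left[1+\frac{(n-3)(1-|\omega_0|^2)(1-|\xi|^2)}{4F(\xi,\omega_0)^2}\right].$$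
   Context: $\mathbb{B}^{n+1}\subset\mathbb{R}^{n+1}$ is the open unit ball, with boundary $\mathbb{S}^n$; $\langle\cdot,\cdot\rangle$ is the Euclidean inner product; $\Delta$ is the Euclidean Laplacian on $\mathbb{R}^{n+1}$ and $\Delta^2=\Delta\circ\Delta$. $\eta$ is the outward-pointing unit normal to $\mathbb{S}^n$, and $\eta v$ denotes the derivative of $v$ in the direction $\eta$. The function $F:\overline{\mathbb{B}^{n+1}}\times\overline{\mathbb{B}^{n+1}}\to\mathbb{R}$ is $$F(\xi,\omega)=\left|\frac{\xi}{|\xi|}-|\xi|\,\omega\right|,$$ extended continuously by $F(0,\omega)=1$; equivalently $F(\xi,\omega)^2=1-2\langle\xi,\omega\rangle+|\xi|^2|\omega|^2$. *)

(* Defs.v *)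
From mathcomp Require Import all_boot all_order all_algebra.
From mathcomp Require Import all_classical all_reals all_analysis.
Import Order.TTheory GRing.Theory Num.Theory.
Import numFieldNormedType.Exports.

Set Implicit Arguments.
Unset Strict Implicit.
Unset Printing Implicit Defensive.

Local Open Scope classical_set_scope.
Local Open Scope ring_scope.

(* The library norm `|x| on 'rV[R]_d is the sup norm; it induces the usual
   topology, but the Euclidean norm has to be introduced separately. *)
Definition dotv (R : realType) (d : nat) (x y : 'rV[R]_d) : R :=
  \sum_(i < d) x 0 i * y 0 i.

Definition enorm (R : realType) (d : nat) (x : 'rV[R]_d) : R :=
  Num.sqrt (dotv x x).

Definition unit_ball (R : realType) (d : nat) : set 'rV[R]_d :=
  [set x | enorm x < 1].

Definition unit_cball (R : realType) (d : nat) : set 'rV[R]_d :=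
  [set x | enorm x <= 1].

Definition unit_sphere (R : realType) (d : nat) : set 'rV[R]_d :=
  [set x | enorm x = 1].

Definition laplacian (R : realType) (n : nat) (v : 'rV[R]_n.+1 -> R) :
    'rV[R]_n.+1 -> R :=
  fun x => \sum_(i < n.+1) 'D_('e_i) ('D_('e_i) v) x.

Definition bilaplacian (R : realType) (n : nat) (v : 'rV[R]_n.+1 -> R) :
    'rV[R]_n.+1 -> R :=
  laplacian (laplacian v).

(* [partials [:: i1; ...; ik] v] is d_{i1} ... d_{ik} v. *)
Definition partials (R : realType) (n : nat) (s : seq 'I_n.+1)
    (v : 'rV[R]_n.+1 -> R) : 'rV[R]_n.+1 -> R :=
  foldr (fun i (u : 'rV[R]_n.+1 -> R) => 'D_('e_i) u) v s.

Definition smooth_on_ball (R : realType) (n : nat) (v : 'rV[R]_n.+1 -> R) :=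
  forall (s : seq 'I_n.+1) (x : 'rV[R]_n.+1), unit_ball x ->
    {for x, continuous (partials s v)} /\
    (forall i : 'I_n.+1, derivable (partials s v) x 'e_i).

(* C^oo up to the boundary: v is continuous on the closed ball and C^oo inside,
   and each partial derivative of each order extends continuously from the open
   ball to the closed one. The values of v outside the closed ball are
   irrelevant. *)
Definition smooth_on_cball (R : realType) (n : nat) (v : 'rV[R]_n.+1 -> R) :=
  [/\ {within (@unit_cball R n.+1), continuous v},
      smooth_on_ball v
    & forall s : seq 'I_n.+1, exists g : 'rV[R]_n.+1 -> R,
        {within (@unit_cball R n.+1), continuous g} /\
        (forall x, unit_ball x -> g x = partials s v x)].

(* The derivative at a point xi of the unit sphere along the outward unit normal,
   which is xi itself. It is one-sided (h -> 0 with h < 0, so that xi + h xi is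
   in the ball) because v is only meaningful on the closed ball. *)
Definition normal_derivative (R : realType) (n : nat) (v : 'rV[R]_n.+1 -> R)
    (xi : 'rV[R]_n.+1) : R :=
  lim ((h^-1 * (v (xi + h *: xi) - v xi)) @[h --> (0 : R)^'-]).

Definition F (R : realType) (d : nat) (xi omega : 'rV[R]_d) : R :=
  if xi == 0 then 1
  else enorm ((enorm xi)^-1 *: xi - enorm xi *: omega).

Definition omega0 (R : realType) (d : nat) (z0 : 'rV[R]_d) : 'rV[R]_d :=
  if z0 == 0 then 0
  else ((1 - Num.sqrt (1 - enorm z0 ^+ 2)) / enorm z0 ^+ 2) *: z0.

(* Main.v *)
(* Uniqueness comes from two applications of the maximum principle. Let [u] be
   the difference of two solutions, so that [u] is biharmonic and vanishes on the
   sphere together with its normal derivative; put [d = n + 1] and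
   [rho = 1 - |x|^2]. Since [Delta (x . grad u) = x . grad (Delta u) + 2 Delta u],
   the function [H = 4 x . grad u + rho Delta u + (2d - 8) u] is harmonic. It
   vanishes on the sphere, so [H = 0]. Written in terms of [p = u / rho], the
   equation [H = 0] is [rho^2 Delta p = 8 p]; and [p] tends to 0 at the sphere
   because the radial derivative of [u] does. Hence [p] has neither a positive
   maximum nor a negative minimum, and [u = 0].

   That the closed forms are solutions follows from
   [|grad Q|^2 = 4 |omega_0|^2 Q] and [Delta Q = 2 d |omega_0|^2] for [Q = F^2]:
   [Q^(1 - d/2)] is harmonic, and [Delta (Q^(2 - d/2))] (respectively
   [Delta (log Q)] if [d = 4]) is a multiple of it. *)
Require Import Defs.
From mathcomp Require Import all_boot all_order all_algebra.
From mathcomp Require Import all_classical all_reals all_analysis.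
From mathcomp Require Import ring lra.
Import Order.TTheory GRing.Theory Num.Theory.
Import numFieldNormedType.Exports.

Local Open Scope classical_set_scope.
Local Open Scope ring_scope.

Set Implicit Arguments.
Unset Strict Implicit.
Unset Printing Implicit Defensive.

(** * One variable *)

Section OneVariable.
Context {R : realType}.

(** Both boundary problems prescribe the normal derivative in terms of the boundary values. The
    difference of [v] and the closed form therefore has zero Dirichlet and Neumann data, and one
    uniqueness statement serves both parts.

    Two obstacles shape the development. Smoothness is given only through iterated partial
    derivatives, so the derivative along a radius and the symmetry of mixed derivatives have to be
    drawn from the mean value theorem. And [v] means nothing outside the closed ball, so its
    boundary derivatives are reached from inside, through the continuous extensions of its partials.

    The point omega_0 is the solution in the ball of 2 omega / (1 + |omega|^2) = z_0. For it, Q = (1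
    + |omega_0|^2) (1 - <z_0, x>) on the sphere, so that f is a power or the logarithm of Q up to a
    constant. To this function of Q the closed forms add 1 - |x|^2 times a harmonic function, which
    is biharmonic and vanishes on the sphere: it corrects the normal derivative without touching the
    boundary values. *)

Lemma is_derive_line (V : normedModType R) (f : V -> R) (x v : V) (s : R) :
  derivable f (s *: v + x) v ->
  is_derive s 1 (fun t : R => f (t *: v + x)) ('D_v f (s *: v + x)).
Proof.
move=> df; rewrite /derive.
have E : (fun h : R => h^-1 *: (((fun t : R => f (t *: v + x)) \o shift s) (h *: 1)
    - f (s *: v + x))) = (fun h : R => h^-1 *: ((f \o shift (s *: v + x)) (h *: v)
    - f (s *: v + x))).
  apply/funext => h /=; congr (_ *: (f _ - _)).
  by rewrite scalerDl addrA [h *: 1]mulr1.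
by split; rewrite /derivable /derive E.
Qed.

(** Restriction to the line through [x] along [v] reduces this to the one-variable chain rule;
    directional derivatives are all that the notion of smoothness used here supplies. *)
Lemma is_derive_comp1 (V : normedModType R) (g : V -> R) (f : R -> R)
    (x v : V) (dg df : R) :
  is_derive x v g dg -> is_derive (g x) 1 f df ->
  is_derive x v (f \o g) (df * dg).
Proof.
move=> [gx <-] [fg <-].
have gl : is_derive (0 : R) 1 (fun t : R => g (t *: v + x)) ('D_v g x).
  by have := @is_derive_line V g x v 0; rewrite scale0r add0r; apply.
have fl : is_derive (g (0 *: v + x)) 1 f ('D_1 f (g x)).
  by rewrite scale0r add0r; split.
have [h1 h2] := @is_derive1_comp _ f _ 0 _ _ fl gl.
have h3 : derivable (f \o g) x v by apply/derivable1P; exact: h1.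
apply: (DeriveDef h3).
rewrite -h2 /derive.
set l := fun t : R => g (t *: v + x).
have -> : (fun h : R => h^-1 *: (((f \o g) \o shift x) (h *: v) - (f \o g) x)) =
    (fun h : R => h^-1 *: (((f \o l) \o shift 0) (h *: 1) - (f \o l) 0)).
  by apply/funext => h; rewrite /l /= addr0 scale0r add0r [h *: 1]mulr1.
by [].
Qed.

(** The increment [b] may have either sign or be 0, so that difference quotients can be treated
    without case distinctions. *)
Lemma MVT_between (p dp : R -> R) (b : R) :
  (forall s : R, `|s| <= `|b| -> is_derive s 1 p (dp s)) ->
  exists2 s : R, `|s| <= `|b| & p b - p 0 = dp s * b.
Proof.
move=> dpP.
have cp (I : set R) : (forall s : R, I s -> `|s| <= `|b|) -> {within I, continuous p}.
  move=> HI; apply/continuous_in_subspaceT => s; rewrite inE => /HI /dpP [h _].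
  exact/differentiable_continuous/derivable1_diffP.
have [b0|b0|b0] := ltgtP b 0.
- have [||c] := @MVT _ p dp _ _ b0.
  + move=> s; rewrite in_itv /= => /andP[h1 h2]; apply: dpP.
    by rewrite ltr0_norm // ltr0_norm // lerN2 ltW.
  + apply: cp => s; rewrite /= in_itv /= => /andP[h1 h2].
    by rewrite ler0_norm // ltr0_norm // lerN2.
  rewrite in_itv /= => /andP[h1 h2] h; exists c.
    by rewrite ltr0_norm // ltr0_norm // lerN2 ltW.
  by rewrite -opprB h; ring.
- have [||c] := @MVT _ p dp _ _ b0.
  + move=> s; rewrite in_itv /= => /andP[h1 h2]; apply: dpP.
    by rewrite gtr0_norm // gtr0_norm // ltW.
  + apply: cp => s; rewrite /= in_itv /= => /andP[h1 h2].
    by rewrite ger0_norm // gtr0_norm.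
  rewrite in_itv /= => /andP[h1 h2] h; exists c.
    by rewrite gtr0_norm // gtr0_norm // ltW.
  by rewrite h subr0.
- by exists 0; rewrite b0 ?subrr ?mulr0.
Qed.

(** The second-derivative test: if [l] were positive, [dp] would be positive just to the right of
    its zero 0, and the mean value theorem would push [p] above [p 0]. *)
Lemma snd_derive_at_max (p dp : R -> R) (l e : R) : 0 < e ->
  (forall s : R, `|s| < e -> is_derive s 1 p (dp s)) ->
  is_derive (0 : R) 1 dp l -> (forall s : R, `|s| < e -> p s <= p 0) ->
  dp 0 = 0 /\ l <= 0.
Proof.
move=> e0 dpP [ddp <-] pmax.
have itv (s : R) : (s \in `]- e, e[) = (`|s| < e) by rewrite in_itv /= ltr_norml.
have dp0 : dp 0 = 0.
  have [_ <-] : is_derive (0 : R) 1 p (dp 0) by apply: dpP; rewrite normr0.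
  have [||||_ ->//] := @derive1_at_max _ p (- e) e 0.
  - by rewrite ge0_cp // ltW.
  - by move=> t; rewrite itv => /dpP [].
  - by rewrite itv normr0.
  - by move=> t; rewrite itv => /pmax.
split => //; rewrite leNgt; apply/negP => l0.
have : (h^-1 *: ((dp \o shift 0) (h *: 1) - dp 0)) @[h --> 0^'] --> 'D_1 dp 0 by [].
move=> /cvgr_gt /(_ _ l0) => /nbhs_ballP [d /= d0 hd].
pose m := Num.min d e / 2.
have m0 : 0 < m by rewrite divr_gt0 // lt_min d0.
have md : m < d by rewrite /m; move: d0 e0; rewrite /Num.min; case: ifP; lra.
have me : m < e by rewrite /m; move: d0 e0; rewrite /Num.min; case: ifP; lra.
have dpos s : 0 < s -> s <= m -> 0 < dp s.
  move=> s0 sm; have := hd s; rewrite /ball /= sub0r normrN gtr0_norm //.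
  move=> /(_ (le_lt_trans sm md)); rewrite gt_eqF // dp0 subr0 addr0.
  by rewrite [s *: 1]mulr1 => /(_ isT); rewrite [_ *: _]mulrC pmulr_lgt0 // invr_gt0.
have dps s : 0 <= s -> s <= m -> is_derive s 1 p (dp s).
  by move=> s0 sm; apply: dpP; rewrite ger0_norm // (le_lt_trans sm).
have [||c] := @MVT _ p dp _ _ m0.
- by move=> s; rewrite in_itv /= => /andP[h1 h2]; apply: dps; exact: ltW.
- apply/continuous_in_subspaceT => s; rewrite inE /= in_itv /= => /andP[h1 h2].
  have [h _] := dps _ h1 h2.
  exact/differentiable_continuous/derivable1_diffP.
rewrite in_itv /= subr0 => /andP[c0 cm] E.
have := pmax m; rewrite gtr0_norm // => /(_ me); apply/negP; rewrite -ltNge.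
by rewrite -subr_gt0 E mulr_gt0 // dpos // ltW.
Qed.

End OneVariable.

(** * Smooth functions on an open set *)

Section Smooth.
Context {R : realType} {n : nat}.
Local Notation V := 'rV[R]_n.+1.
Implicit Types (A : set V) (u w : V -> R) (x : V) (i j : 'I_n.+1) (k : nat).

Local Notation pd i u := ('D_('e_i) u).

(** The order is a recursion parameter because closure under products and powers is proved by
    induction on it. The domain is a parameter because [v] is smooth on the open ball, but the
    closed forms on a neighbourhood of the closed one. *)
Fixpoint Ck A k u : Prop :=
  (forall x, A x -> {for x, continuous u}) /\
  if k is k'.+1 then
    (forall i x, A x -> derivable u x 'e_i) /\ (forall i, Ck A k' (pd i u))
  else True.

Definition smooth_on A u := forall k, Ck A k u.

Lemma Ck_continuous A k u x : Ck A k u -> A x -> {for x, continuous u}.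
Proof. by case: k => [|k] [] uc _; apply: uc. Qed.

Lemma CkS A k u : Ck A k.+1 u -> Ck A k u.
Proof.
elim: k u => [|k IH] u [uc [ud uk]]; first by split.
by split => //; split => // i; apply: IH.
Qed.

Lemma sub_Ck A B k u : A `<=` B -> Ck B k u -> Ck A k u.
Proof.
move=> AB; elim: k u => [|k IH] u [uc]; first by split => // x /AB /uc.
move=> [ud uk]; split=> [x /AB /uc //|]; split => [i x /AB|i]; first exact: ud.
exact/IH/uk.
Qed.

Lemma sub_smooth A B u : A `<=` B -> smooth_on B u -> smooth_on A u.
Proof. by move=> AB us k; exact: sub_Ck (us k). Qed.

Lemma smooth_continuous A u x : smooth_on A u -> A x -> {for x, continuous u}.
Proof. by move=> us; exact: (Ck_continuous (us 0%N)). Qed.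

Lemma smooth_derivable A u x i : smooth_on A u -> A x -> derivable u x 'e_i.
Proof. by move=> us; case: (us 1%N) => _ [+ _]; exact. Qed.

Lemma smooth_pd A u i : smooth_on A u -> smooth_on A (pd i u).
Proof. by move=> us k; case: (us k.+1) => _ [_]; exact. Qed.

Lemma near_open A x (P : V -> Prop) :
  open A -> A x -> (forall y, A y -> P y) -> \forall y \near x, P y.
Proof.
by move=> oA Ax AP; move: (open_nbhs_nbhs (conj oA Ax)); apply: filterS.
Qed.

Lemma eq_continuous_at A u w x : open A -> A x -> (forall y, A y -> u y = w y) ->
  {for x, continuous u} -> {for x, continuous w}.
Proof.
move=> oA Ax uw; rewrite /prop_for /continuous_at -uw // => uc.
have H : \forall y \near x, u y = w y.
  exact: near_open oA Ax uw.
exact: cvg_trans (near_eq_cvg H) uc.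
Qed.

Lemma eq_pd A u w x i : open A -> A x -> (forall y, A y -> u y = w y) ->
  pd i u x = pd i w x.
Proof. by move=> oA Ax uw; apply: near_eq_derive; exact: near_open uw. Qed.

Lemma eq_Ck A k u w : open A -> (forall y, A y -> u y = w y) ->
  Ck A k u -> Ck A k w.
Proof.
move=> oA; elim: k u w => [|k IH] u w uw [uc].
  move=> _; split => // x Ax; exact: eq_continuous_at uw (uc x Ax).
move=> [ud uk]; split.
  move=> x Ax; exact: eq_continuous_at uw (uc x Ax).
split => [i x Ax|i].
  by apply: near_eq_derivable (ud i x Ax); exact: near_open uw.
apply: IH (uk i) => y Ay; exact: eq_pd uw.
Qed.

Lemma eq_smooth A u w : open A -> (forall y, A y -> u y = w y) ->
  smooth_on A u -> smooth_on A w.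
Proof. by move=> oA uw us k; exact: eq_Ck (us k). Qed.

Lemma pdD u w x i : derivable u x 'e_i -> derivable w x 'e_i ->
  pd i (fun y => u y + w y) x = pd i u x + pd i w x.
Proof. exact: deriveD. Qed.

Lemma pdM u w x i : derivable u x 'e_i -> derivable w x 'e_i ->
  pd i (fun y => u y * w y) x = u x * pd i w x + w x * pd i u x.
Proof. exact: deriveM. Qed.

Lemma pd_cst (c : R) x i : pd i (fun=> c) x = 0.
Proof. exact: derive_cst. Qed.

Lemma is_derive_coord x i j :
  is_derive x 'e_i (fun y : V => y 0 j) (i == j)%:R.
Proof.
have H : (h^-1 *: ((((fun y : V => y 0 j) \o shift x) (h *: 'e_i) - x 0 j) : R)
    @[h --> (0 : R)^']) --> ((i == j)%:R : R).
  apply: cvg_near_cst; near=> h; rewrite /= !mxE addrK eqxx /= eq_sym.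
  rewrite /GRing.scale /= mulrA mulVf ?mul1r //; near: h.
  exact: nbhs_dnbhs_neq.
have dc : derivable (fun y : V => y 0 j) x 'e_i by apply/cvg_ex; eexists; exact: H.
by apply: (DeriveDef dc); exact: cvg_lim H.
Unshelve. all: by end_near. Qed.

Lemma Ck_cst A k (c : R) : open A -> Ck A k (fun=> c).
Proof.
move=> oA; elim: k c => [|k IH] c; split => //; try by move=> x _; exact: cst_continuous.
split => [i x _|i]; first exact: derivable_cst.
by apply: eq_Ck (IH 0) => // y _; rewrite pd_cst.
Qed.

Lemma smooth_cst A (c : R) : open A -> smooth_on A (fun=> c).
Proof. by move=> oA k; exact: Ck_cst. Qed.

Lemma smooth_coord A j : open A -> smooth_on A (fun x => x 0 j).
Proof.
move=> oA [|k]; split => //; try by move=> x _; exact: coord_continuous.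
split => [i x _|i]; first by case: (is_derive_coord x i j).
apply: eq_Ck (@Ck_cst A k (i == j)%:R oA) => // y _.
by case: (is_derive_coord y i j).
Qed.

Lemma CkD A k u w : open A -> Ck A k u -> Ck A k w -> Ck A k (fun x => u x + w x).
Proof.
move=> oA; elim: k u w => [|k IH] u w.
  by move=> [uc _] [wc _]; split=> // x Ax; exact: continuousD (uc x Ax) (wc x Ax).
move=> [uc [ud uk]] [wc [wd wk]]; split.
  by move=> x Ax; exact: continuousD (uc x Ax) (wc x Ax).
split => [i x Ax|i]; first exact: derivableD (ud _ _ Ax) (wd _ _ Ax).
apply: eq_Ck (IH _ _ (uk i) (wk i)) => // y Ay.
by rewrite pdD //; [exact: ud|exact: wd].
Qed.

Lemma CkM A k u w : open A -> Ck A k u -> Ck A k w -> Ck A k (fun x => u x * w x).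
Proof.
move=> oA; elim: k u w => [|k IH] u w.
  by move=> [uc _] [wc _]; split=> // x Ax; exact: continuousM (uc x Ax) (wc x Ax).
move=> us ws; have [uc [ud uk]] := us; have [wc [wd wk]] := ws; split.
  by move=> x Ax; exact: continuousM (uc x Ax) (wc x Ax).
split => [i x Ax|i]; first exact: derivableM (ud _ _ Ax) (wd _ _ Ax).
apply: eq_Ck (CkD oA (IH _ _ (CkS us) (wk i)) (IH _ _ (CkS ws) (uk i))) => // y Ay.
by rewrite pdM //; [exact: ud|exact: wd].
Qed.

Lemma smoothD A u w : open A -> smooth_on A u -> smooth_on A w ->
  smooth_on A (fun x => u x + w x).
Proof. by move=> oA us ws k; exact: CkD. Qed.

Lemma smoothM A u w : open A -> smooth_on A u -> smooth_on A w ->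
  smooth_on A (fun x => u x * w x).
Proof. by move=> oA us ws k; exact: CkM. Qed.

Lemma smoothZ A (c : R) u : open A -> smooth_on A u -> smooth_on A (fun x => c * u x).
Proof. by move=> oA us; apply: smoothM => //; exact: smooth_cst. Qed.

Lemma smoothB A u w : open A -> smooth_on A u -> smooth_on A w ->
  smooth_on A (fun x => u x - w x).
Proof.
move=> oA us ws; apply: eq_smooth (smoothD oA us (smoothZ (-1) oA ws)) => // y _.
by rewrite mulN1r.
Qed.

Lemma smooth_sum A (I : Type) (r : seq I) (f : I -> V -> R) : open A ->
  (forall a : I, smooth_on A (f a)) -> smooth_on A (fun x => \sum_(i <- r) f i x).
Proof.
move=> oA fs; elim: r => [|a r IH].
  by apply: eq_smooth (smooth_cst 0 oA) => // y _; rewrite big_nil.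
by apply: eq_smooth (smoothD oA (fs a) IH) => // y _; rewrite big_cons.
Qed.

Lemma is_derive_powR u x i (a : R) : 0 < u x -> derivable u x 'e_i ->
  is_derive x 'e_i (fun y => u y `^ a) (a * u x `^ (a - 1) * pd i u x).
Proof.
move=> u0 du; have /derivableP du' := du.
exact: (is_derive_comp1 du' (is_derive1_powR a u0)).
Qed.

Lemma is_derive_ln u x i : 0 < u x -> derivable u x 'e_i ->
  is_derive x 'e_i (fun y => ln (u y)) ((u x)^-1 * pd i u x).
Proof.
move=> u0 du; have /derivableP du' := du.
exact: (is_derive_comp1 du' (is_derive1_ln u0)).
Qed.

Lemma is_derive1_continuous (f : R -> R) (x l : R) :
  is_derive x 1 f l -> {for x, continuous f}.
Proof. by move=> [h _]; exact/differentiable_continuous/derivable1_diffP. Qed.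

Lemma continuous_powRl u x (a : R) : 0 < u x -> {for x, continuous u} ->
  {for x, continuous (fun y => u y `^ a)}.
Proof.
move=> u0 uc; apply: (@continuous_comp _ _ _ u (fun t : R => t `^ a)) => //.
exact: is_derive1_continuous (is_derive1_powR a u0).
Qed.

Lemma smooth_powR A u (a : R) : open A -> smooth_on A u ->
  (forall x, A x -> 0 < u x) -> smooth_on A (fun x => u x `^ a).
Proof.
(* The exponent is generalised, since differentiation replaces [a] by [a - 1]. *)
move=> oA us u0 k; elim: k a => [|k IH] a; split => //.
- by move=> x Ax; apply: continuous_powRl (u0 _ Ax) (smooth_continuous us Ax).
- by move=> x Ax; apply: continuous_powRl (u0 _ Ax) (smooth_continuous us Ax).
have D i x : A x -> is_derive x 'e_i (fun y => u y `^ a)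
    (a * u x `^ (a - 1) * pd i u x).
  by move=> Ax; exact: (is_derive_powR a (u0 _ Ax) (smooth_derivable us Ax)).
split => [i x /(D i) []//|i].
have uk : Ck A k (pd i u) := smooth_pd i us k.
apply: eq_Ck (CkM oA (CkM oA (Ck_cst k a oA) (IH (a - 1))) uk) => // y.
by move=> /(D i) [].
Qed.

Lemma smooth_ln A u : open A -> smooth_on A u ->
  (forall x, A x -> 0 < u x) -> smooth_on A (fun x => ln (u x)).
Proof.
move=> oA us u0.
have D i x : A x -> is_derive x 'e_i (fun y => ln (u y)) ((u x)^-1 * pd i u x).
  by move=> Ax; exact: (is_derive_ln (u0 _ Ax) (smooth_derivable us Ax)).
have lc x : A x -> {for x, continuous (fun x => ln (u x))}.
  move=> Ax; apply: (@continuous_comp _ _ _ u (@ln R)).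
    exact: smooth_continuous us Ax.
  exact: is_derive1_continuous (is_derive1_ln (u0 _ Ax)).
case=> [|k]; split => //; split => [i x /(D i) []//|i].
(* No induction here: the gradient of the logarithm is a power times a smooth function. *)
have us1 : smooth_on A (fun x => u x `^ (-1)) by exact: smooth_powR.
apply: eq_Ck (CkM oA (us1 k) (smooth_pd i us k)) => // y Ay.
by rewrite powR_inv1 ?(ltW (u0 _ Ay)) //; case: (D i y Ay).
Qed.

End Smooth.

(** * Directional and mixed derivatives *)

Section Mixed.
Context {R : realType} {n : nat}.
Local Notation V := 'rV[R]_n.+1.
Implicit Types (A : set V) (u w : V -> R) (x : V) (i j : 'I_n.+1) (k : nat).
Local Notation pd i u := ('D_('e_i) u).

Lemma open_norm_ball A x : open A -> A x ->
  exists2 d : R, 0 < d & forall y : V, `|x - y| < d -> A y.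
Proof.
move=> oA Ax; have /nbhs_normP[d /= d0 H] := open_nbhs_nbhs (conj oA Ax).
by exists d => // y xy; apply: H.
Qed.

Lemma continuous_norm_ball u x (e : R) : {for x, continuous u} -> 0 < e ->
  exists2 d : R, 0 < d & forall y : V, `|x - y| < d -> `|u x - u y| < e.
Proof.
move=> /cvgrPdist_lt /(_ e) + e0 => /(_ e0) /nbhs_normP[d /= d0 H].
by exists d => // y xy; apply: H.
Qed.

(** Directions are built up one coordinate at a time. The extra increment along ['e_i] starts at
    [h *: v + x]; the mean value theorem turns it into [c] times a value of the partial derivative
    near [x], and continuity of that partial derivative gives the limit. *)
Lemma is_derive_dir_step A u x (v : V) (c l : R) i : open A -> smooth_on A u ->
  A x -> is_derive x v u l ->
  is_derive x (v + c *: 'e_i) u (l + c * pd i u x).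
Proof.
move=> oA us Ax [du <-].
pose g h := h^-1 *: (u (h *: (v + c *: 'e_i) + x) - u (h *: v + x)).
have gc : g h @[h --> (0 : R)^'] --> c * pd i u x.
  apply/cvgrPdist_lt => e e0.
  have [d1 d10 H1] := open_norm_ball oA Ax.
  have c0 : 0 < `|c| + 1 by rewrite ltr_wpDl.
  have [||d2 d20 H2] := @continuous_norm_ball (pd i u) x (e / (`|c| + 1)).
  - exact: smooth_continuous (smooth_pd i us) Ax.
  - by rewrite divr_gt0.
  pose d := Num.min d1 d2.
  have d0 : 0 < d by rewrite lt_min d10.
  pose N : R := `|c| * `|'e_i : V| + `|v| + 1.
  have N0 : 0 < N by rewrite ltr_wpDl // addr_ge0 // mulr_ge0.
  near=> h.
  have h0 : h != 0 by near: h; exact: nbhs_dnbhs_neq.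
  have hd : `|h| * N < d.
    rewrite -ltr_pdivlMr //; near: h.
    apply: dnbhs0_lt; exact: divr_gt0.
  have close s : `|s| <= `|h * c| -> `|x - (s *: 'e_i + (h *: v + x))| < d.
    move=> sh; apply: le_lt_trans hd; rewrite addrA opprD addrCA subrr addr0 normrN.
    rewrite (le_trans (ler_normD _ _)) // !normrZ /N !mulrDr mulr1 mulrA -normrM.
    by rewrite -addrA lerD // ?ler_wpM2r // lerDl.
  have [|s sh] := @MVT_between _ (fun s => u (s *: 'e_i + (h *: v + x)))
      (fun s => pd i u (s *: 'e_i + (h *: v + x))) (h * c).
    move=> s /close; rewrite lt_min => /andP[sd _].
    by apply: is_derive_line; apply: (smooth_derivable us); exact: H1.
  rewrite scale0r add0r => E.
  have -> : g h = c * pd i u (s *: 'e_i + (h *: v + x)).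
    have L : h *: (v + c *: 'e_i) + x = (h * c) *: 'e_i + (h *: v + x).
      by rewrite scalerDr scalerA addrA [h *: v + _]addrC.
    by rewrite /g L E /GRing.scale /=; field.
  rewrite -mulrBr normrM.
  have := close _ sh; rewrite lt_min => /andP[_ /H2].
  rewrite ltr_pdivlMr // => H; apply: le_lt_trans H.
  by rewrite mulrC ler_wpM2l // lerDl.
have uc : (h^-1 *: (u (h *: v + x) - u x)) @[h --> (0 : R)^'] --> 'D_v u x by [].
have H : (h^-1 *: ((u \o shift x) (h *: (v + c *: 'e_i)) - u x)) @[h --> (0 : R)^']
    --> 'D_v u x + c * pd i u x.
  apply: cvg_trans (cvgD uc gc); apply: near_eq_cvg; near=> h.
  rewrite /g fctE /= /GRing.scale /=; ring.
have D : derivable u x (v + c *: 'e_i) by apply/cvg_ex; eexists; exact: H.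
by apply: (DeriveDef D); exact: cvg_lim H.
Unshelve. all: by end_near. Qed.

Lemma is_derive_dir A u x (v : V) : open A -> smooth_on A u -> A x ->
  is_derive x v u (\sum_i v 0 i * pd i u x).
Proof.
move=> oA us Ax.
suff H (r : seq 'I_n.+1) : is_derive x (\sum_(i <- r) v 0 i *: 'e_i) u
    (\sum_(i <- r) v 0 i * pd i u x) by rewrite {1}(row_sum_delta v); exact: H.
elim: r => [|a r IH]; first by rewrite !big_nil; exact: is_derive0.
rewrite !big_cons [_ *: _ + _]addrC [_ * _ + _]addrC.
exact: (is_derive_dir_step _ _ oA us Ax IH).
Qed.

(** Schwarz's argument: the mean value theorem is applied along ['e_i] to a difference in the
    direction ['e_j], then along ['e_j] to the partial derivative so obtained. *)
Lemma double_difference A u x i j (h d : R) : smooth_on A u ->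
  (forall y : V, `|x - y| < d -> A y) ->
  `|h| * (`|'e_i : V| + `|'e_j : V|) < d ->
  exists2 y : V, `|x - y| < d &
    u (h *: 'e_i + (h *: 'e_j + x)) - u (h *: 'e_i + x)
      - (u (h *: 'e_j + x) - u x) = pd j (pd i u) y * (h * h).
Proof.
move=> us dA hd.
have close s t : `|s| <= `|h| -> `|t| <= `|h| ->
    `|x - (s *: 'e_i + (t *: 'e_j + x))| < d.
  move=> sh th; apply: le_lt_trans hd.
  rewrite addrA opprD addrCA subrr addr0 normrN.
  by rewrite (le_trans (ler_normD _ _)) // !normrZ mulrDr lerD // ler_wpM2r.
have [|s sh] := @MVT_between _
    (fun s => u (s *: 'e_i + (h *: 'e_j + x)) - u (s *: 'e_i + x))
    (fun s => pd i u (s *: 'e_i + (h *: 'e_j + x)) - pd i u (s *: 'e_i + x)) h.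
  move=> s sh; apply: is_deriveB; apply: is_derive_line;
    apply: (smooth_derivable us); apply: dA; first exact: close.
  by have := close s 0 sh; rewrite normr0 scale0r add0r; exact.
rewrite !scale0r !add0r => ->.
have [|t th] := @MVT_between _
    (fun t => pd i u (t *: 'e_j + (s *: 'e_i + x)))
    (fun t => pd j (pd i u) (t *: 'e_j + (s *: 'e_i + x))) h.
  move=> t th; apply: is_derive_line; apply: (smooth_derivable (smooth_pd i us)).
  by apply: dA; rewrite addrCA; exact: close.
rewrite scale0r add0r addrCA => ->; exists (t *: 'e_j + (s *: 'e_i + x)).
  by rewrite addrCA; exact: close.
by rewrite mulrA.
Qed.

Lemma pd_comm A u x i j : open A -> smooth_on A u -> A x ->
  pd i (pd j u) x = pd j (pd i u) x.
Proof.
move=> oA us Ax; apply/eqP; rewrite -subr_eq0 -normr_eq0 eq_le normr_ge0 andbT.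
apply/ler_addgt0Pl => e e0; rewrite addr0.
have [d1 d10 H1] := open_norm_ball oA Ax.
have e2 : 0 < e / 2 by rewrite divr_gt0.
have cont a b : {for x, continuous (pd a (pd b u))}.
  exact: smooth_continuous (smooth_pd a (smooth_pd b us)) Ax.
have [d2 d20 H2] := continuous_norm_ball (cont i j) e2.
have [d3 d30 H3] := continuous_norm_ball (cont j i) e2.
pose d := Num.min d1 (Num.min d2 d3).
have d0 : 0 < d by rewrite !lt_min d10 d20.
pose N : R := `|'e_i : V| + `|'e_j : V| + 1.
have N0 : 0 < N by rewrite ltr_wpDl // addr_ge0.
pose h := d / (N + 1).
have h0 : 0 < h by rewrite divr_gt0 // addr_gt0.
have hd : `|h| * (`|'e_i : V| + `|'e_j : V|) < d.
  have N1 : 0 < N + 1 by rewrite addr_gt0.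
  rewrite gtr0_norm // /h -mulrA gtr_pMr // mulrC ltr_pdivrMr // mul1r.
  by rewrite /N -addrA ltrDl addr_gt0.
have dA (y : V) : `|x - y| < d -> A y.
  by rewrite lt_min => /andP[/H1].
have [y1 xy1 E1] := double_difference us dA hd.
rewrite [X in _ * X]addrC in hd.
have [y2 xy2 E2] := double_difference us dA hd.
(* The second difference is symmetric in [i] and [j], so the two mixed derivatives agree at two
   points close to [x]; their continuity does the rest. *)
have E : pd j (pd i u) y1 = pd i (pd j u) y2.
  apply: (mulIf (mulf_neq0 (lt0r_neq0 h0) (lt0r_neq0 h0))).
  have swap (a b c e' : R) : a - b - (c - e') = a - c - (b - e') by ring.
  by rewrite -[LHS]E1 -[RHS]E2 [LHS]swap; congr (u _ - _ - _); exact: addrCA.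
have := xy1; rewrite !lt_min => /and3P[_ _ /H3 K1].
have := xy2; rewrite !lt_min => /and3P[_ /H2 K2 _].
rewrite E distrC in K1.
apply: (le_trans (ler_distD (pd i (pd j u) y2) _ _)).
rewrite [e]splitr; exact: lerD (ltW K2) (ltW K1).
Qed.

End Mixed.

(** * The Laplacian and the Euler operator *)

Section Laplacian.
Context {R : realType} {n : nat}.
Local Notation V := 'rV[R]_n.+1.
Implicit Types (A : set V) (u w : V -> R) (x : V) (i j : 'I_n.+1) (k : nat).
Local Notation pd i u := ('D_('e_i) u).

(** The operator x . grad, which on the unit sphere is the outward normal derivative. *)
Definition euler u x : R := \sum_i x 0 i * pd i u x.

Lemma smooth_laplacian A u : open A -> smooth_on A u -> smooth_on A (laplacian u).
Proof.
by move=> oA us; apply: smooth_sum => // i; exact: smooth_pd (smooth_pd i us).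
Qed.

Lemma smooth_euler A u : open A -> smooth_on A u -> smooth_on A (euler u).
Proof.
move=> oA us; apply: smooth_sum => // i; apply: smoothM => //.
  exact: smooth_coord.
exact: smooth_pd.
Qed.

Lemma smooth_dotv A (a : V) : open A -> smooth_on A (fun x => dotv x a).
Proof.
move=> oA; apply: smooth_sum => // i; apply: smoothM => //.
  exact: smooth_coord.
exact: smooth_cst.
Qed.

Lemma smooth_dotvv A : open A -> smooth_on A (fun x => dotv x x).
Proof. by move=> oA; apply: smooth_sum => // i; apply: smoothM => //; exact: smooth_coord. Qed.

Lemma eq_laplacian A u w x : open A -> A x -> (forall y, A y -> u y = w y) ->
  laplacian u x = laplacian w x.
Proof.
move=> oA Ax uw; apply: eq_bigr => i _.
by apply: (eq_pd _ oA Ax) => y Ay; exact: (eq_pd _ oA Ay uw).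
Qed.

Lemma eq_euler A u w x : open A -> A x -> (forall y, A y -> u y = w y) ->
  euler u x = euler w x.
Proof. by move=> oA Ax uw; apply: eq_bigr => i _; congr (_ * _); exact: (eq_pd _ oA Ax uw). Qed.

Lemma eulerD A u w x : smooth_on A u -> smooth_on A w -> A x ->
  euler (fun y => u y + w y) x = euler u x + euler w x.
Proof.
move=> us ws Ax; rewrite /euler -big_split /=; apply: eq_bigr => i _.
rewrite -mulrDr pdD //; [exact: smooth_derivable us Ax|exact: smooth_derivable ws Ax].
Qed.

Lemma eulerM A u w x : smooth_on A u -> smooth_on A w -> A x ->
  euler (fun y => u y * w y) x = u x * euler w x + w x * euler u x.
Proof.
move=> us ws Ax; rewrite /euler !mulr_sumr -big_split /=; apply: eq_bigr => i _.
rewrite pdM; [|exact: smooth_derivable us Ax|exact: smooth_derivable ws Ax].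
by rewrite mulrDr !mulrA [_ * u x]mulrC [_ * w x]mulrC.
Qed.

Lemma laplacianD A u w x : open A -> smooth_on A u -> smooth_on A w -> A x ->
  laplacian (fun y => u y + w y) x = laplacian u x + laplacian w x.
Proof.
move=> oA us ws Ax; rewrite /laplacian -big_split /=; apply: eq_bigr => i _.
have -> : pd i (pd i (fun y => u y + w y)) x = pd i (fun y => pd i u y + pd i w y) x.
  apply: (eq_pd _ oA Ax) => y Ay.
  by rewrite pdD //; [exact: smooth_derivable us Ay|exact: smooth_derivable ws Ay].
rewrite pdD //; first exact: smooth_derivable (smooth_pd i us) Ax.
exact: smooth_derivable (smooth_pd i ws) Ax.
Qed.

Lemma laplacianM A u w x : open A -> smooth_on A u -> smooth_on A w -> A x ->
  laplacian (fun y => u y * w y) x =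
    u x * laplacian w x + 2 * (\sum_i pd i u x * pd i w x) + w x * laplacian u x.
Proof.
move=> oA us ws Ax; rewrite /laplacian !mulr_sumr -!big_split /=.
apply: eq_bigr => i _.
have -> : pd i (pd i (fun y => u y * w y)) x =
    pd i (fun y => u y * pd i w y + w y * pd i u y) x.
  apply: (eq_pd _ oA Ax) => y Ay.
  by rewrite pdM //; [exact: smooth_derivable us Ay|exact: smooth_derivable ws Ay].
have du := smooth_derivable us Ax; have dw := smooth_derivable ws Ax.
have ddu := smooth_derivable (smooth_pd i us) Ax.
have ddw := smooth_derivable (smooth_pd i ws) Ax.
rewrite pdD; [|exact: derivableM (du i) (ddw i)|exact: derivableM (dw i) (ddu i)].
rewrite (pdM (du i) (ddw i)) (pdM (dw i) (ddu i)).
move: (u x) (w x) (pd i u x) (pd i w x) (pd i _ x) (pd i _ x) => *; ring.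
Qed.

Lemma laplacian_cst (c : R) x : laplacian (fun=> c : R) x = 0.
Proof.
rewrite /laplacian big1 // => i _.
have -> : pd i (fun=> c : R) = (fun=> 0 : R) :> (V -> R) by apply/funext => y; rewrite pd_cst.
by rewrite pd_cst.
Qed.

Lemma euler_cst (c : R) x : euler (fun=> c : R) x = 0.
Proof. by rewrite /euler big1 // => i _; rewrite pd_cst mulr0. Qed.

Lemma laplacianZ A (c : R) u x : open A -> smooth_on A u -> A x ->
  laplacian (fun y => c * u y) x = c * laplacian u x.
Proof.
move=> oA us Ax; rewrite (laplacianM oA (smooth_cst c oA) us Ax).
rewrite laplacian_cst mulr0 addr0 big1 ?mulr0 ?addr0 // => i _.
by rewrite pd_cst mul0r.
Qed.

Lemma eulerZ A (c : R) u x : open A -> smooth_on A u -> A x ->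
  euler (fun y => c * u y) x = c * euler u x.
Proof.
by move=> oA us Ax; rewrite (eulerM (smooth_cst c oA) us Ax) euler_cst mulr0 addr0.
Qed.

Lemma bilaplacianD A u w x : open A -> smooth_on A u -> smooth_on A w -> A x ->
  bilaplacian (fun y => u y + w y) x = bilaplacian u x + bilaplacian w x.
Proof.
move=> oA us ws Ax; rewrite -(laplacianD oA _ _ Ax); try exact: smooth_laplacian.
by apply: (eq_laplacian oA Ax) => y; exact: laplacianD.
Qed.

Lemma bilaplacianZ A (c : R) u x : open A -> smooth_on A u -> A x ->
  bilaplacian (fun y => c * u y) x = c * bilaplacian u x.
Proof.
move=> oA us Ax; rewrite -(laplacianZ c oA _ Ax); last exact: smooth_laplacian.
by apply: (eq_laplacian oA Ax) => y; exact: laplacianZ.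
Qed.

Lemma pd_sum (I : Type) (r : seq I) (f : I -> V -> R) x i :
  (forall a, derivable (f a) x 'e_i) ->
  pd i (fun y => \sum_(a <- r) f a y) x = \sum_(a <- r) pd i (f a) x.
Proof.
move=> df.
suff [] : is_derive x 'e_i (fun y => \sum_(a <- r) f a y) (\sum_(a <- r) pd i (f a) x).
  by [].
elim: r => [|a r IH].
  rewrite big_nil; under [X in is_derive _ _ X _]eq_fun do rewrite big_nil.
  exact: is_derive_cst.
rewrite big_cons; under [X in is_derive _ _ X _]eq_fun do rewrite big_cons.
by apply: is_deriveD IH; exact/derivableP.
Qed.

Lemma pd_coord x i j : pd i (fun y : V => y 0 j) x = (i == j)%:R.
Proof. by case: (is_derive_coord x i j). Qed.

Lemma pd_dotv (a : V) x i : pd i (fun y => dotv y a) x = a 0 i.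
Proof.
have dc j : derivable (fun y : V => y 0 j) x 'e_i by case: (is_derive_coord x i j).
have da j : derivable (fun=> a 0 j : R) x 'e_i by exact: derivable_cst.
rewrite pd_sum => [|j]; last exact: derivableM (dc j) (da j).
rewrite (bigD1 i) //= big1 => [|j ij]; rewrite (pdM (dc _) (da _)) pd_cst pd_coord.
  by rewrite eqxx mulr1 mulr0 add0r addr0.
by rewrite eq_sym (negbTE ij) !mulr0 addr0.
Qed.

Lemma pd_dotvv x i : pd i (fun y => dotv y y) x = 2 * x 0 i.
Proof.
have dc j : derivable (fun y : V => y 0 j) x 'e_i by case: (is_derive_coord x i j).
rewrite pd_sum => [|j]; last exact: derivableM (dc j) (dc j).
rewrite (bigD1 i) //= big1 => [|j ij]; rewrite pdM // pd_coord.
  by rewrite eqxx mulr1 addr0; ring.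
by rewrite [i == j]eq_sym (negbTE ij) !mulr0 addr0.
Qed.

Lemma euler_dotvv x : euler (fun y => dotv y y) x = 2 * dotv x x.
Proof. by rewrite /euler [in RHS]/dotv mulr_sumr; apply: eq_bigr => i _; rewrite pd_dotvv; ring. Qed.

Lemma laplacian_dotvv x : laplacian (fun y => dotv y y) x = 2 * n.+1%:R.
Proof.
rewrite /laplacian (eq_bigr (fun=> 2)) => [|i _].
  by rewrite sumr_const card_ord mulr_natr.
have -> : pd i (fun y => dotv y y) = (fun y : V => 2 * y 0 i).
  by apply/funext => y; rewrite pd_dotvv.
have dc : derivable (fun y : V => y 0 i) x 'e_i by case: (is_derive_coord x i i).
have d2 : derivable (fun=> 2 : R) x 'e_i by exact: derivable_cst.
by rewrite (pdM d2 dc) pd_cst pd_coord eqxx mulr0 addr0 mulr1.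
Qed.

Lemma laplacian_dotvvM A w x : open A -> smooth_on A w -> A x ->
  laplacian (fun y => (1 - dotv y y) * w y) x =
    (1 - dotv x x) * laplacian w x - 4 * euler w x - 2 * n.+1%:R * w x.
Proof.
move=> oA ws Ax; have ds : smooth_on A (fun y => dotv y y) := smooth_dotvv oA.
have E y : (1 - dotv y y) * w y = w y + (-1) * (dotv y y * w y) by ring.
have -> : laplacian (fun y => (1 - dotv y y) * w y) x =
    laplacian (fun y => w y + (-1) * (dotv y y * w y)) x.
  by apply: (eq_laplacian oA Ax) => y _; exact: E.
have dws := smoothM oA ds ws.
rewrite (laplacianD oA ws (smoothZ (-1) oA dws) Ax) (laplacianZ _ oA dws Ax).
rewrite (laplacianM oA ds ws Ax) laplacian_dotvv.
have -> : \sum_i pd i (fun y => dotv y y) x * pd i w x = 2 * euler w x.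
  by rewrite /euler mulr_sumr; apply: eq_bigr => i _; rewrite pd_dotvv; ring.
ring.
Qed.

Lemma laplacian_euler A u x : open A -> smooth_on A u -> A x ->
  laplacian (euler u) x = euler (laplacian u) x + 2 * laplacian u x.
Proof.
move=> oA us Ax.
have sc j : smooth_on A (fun y : V => y 0 j) by exact: smooth_coord.
have su j := smooth_pd j us.
pose f j (y : V) := y 0 j * pd j u y.
have sf j : smooth_on A (f j) by exact: smoothM.
have E1 y i : A y -> pd i (euler u) y = \sum_j pd i (f j) y.
  by move=> Ay; rewrite pd_sum // => j; exact: smooth_derivable (sf j) Ay.
have L : laplacian (euler u) x = \sum_j laplacian (f j) x.
  rewrite /laplacian exchange_big /=; apply: eq_bigr => i _.
  rewrite -pd_sum => [|j]; last exact: smooth_derivable (smooth_pd i (sf j)) Ax.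
  by apply: (eq_pd _ oA Ax) => y Ay; exact: E1.
have C j : laplacian (fun y : V => y 0 j) x = 0.
  rewrite /laplacian big1 // => i _.
  have -> : pd i (fun y : V => y 0 j) = (fun=> (i == j)%:R : R).
    by apply/funext => y; rewrite pd_coord.
  by rewrite pd_cst.
(* Third derivatives are permuted by two uses of symmetry, one for [u] and one for [pd i u]. *)
have D j : laplacian (pd j u) x = pd j (laplacian u) x.
  rewrite pd_sum => [|i]; last first.
    exact: smooth_derivable (smooth_pd i (smooth_pd i us)) Ax.
  apply: eq_bigr => i _; transitivity (pd i (pd j (pd i u)) x); last first.
    exact: (pd_comm i j oA (smooth_pd i us) Ax).
  by apply: (eq_pd _ oA Ax) => y Ay; exact: (pd_comm i j oA us Ay).
rewrite L /euler mulr_sumr -big_split /=; apply: eq_bigr => j _.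
rewrite (laplacianM oA (sc j) (su j) Ax) C D mulr0 addr0; congr (_ + 2 * _).
rewrite (bigD1 j) //= big1 => [|i ij]; rewrite pd_coord.
  by rewrite eqxx mul1r addr0.
by rewrite (negbTE ij) mul0r.
Qed.

(* With [u = h1 - (1 - |x|^2) h2] the Almansi decomposition of a biharmonic
   function, this is the harmonic function [4 x . grad h1 + (2d - 8) h1 + 8 h2]. *)
Definition almansi u x : R :=
  4 * euler u x + ((1 - dotv x x) * laplacian u x + (2 * n.+1%:R - 8) * u x).

Lemma smooth_rho A : open A -> smooth_on A (fun x => 1 - dotv x x).
Proof. by move=> oA; apply: smoothB => //; [exact: smooth_cst|exact: smooth_dotvv]. Qed.

Lemma smooth_almansi A u : open A -> smooth_on A u -> smooth_on A (almansi u).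
Proof.
move=> oA us; apply: smoothD => //; first exact: smoothZ oA (smooth_euler oA us).
apply: smoothD => //; last exact: smoothZ.
exact: smoothM (smooth_rho oA) (smooth_laplacian oA us).
Qed.

(** The coefficients are made to cancel. With d = n + 1, E the Euler operator and
    [bilaplacian u x = 0], the three terms contribute 4 E(Delta u) + 8 Delta u, then - 4 E(Delta u)
    - 2d Delta u, then (2d - 8) Delta u. *)
Lemma laplacian_almansi A u x : open A -> smooth_on A u -> A x ->
  bilaplacian u x = 0 -> laplacian (almansi u) x = 0.
Proof.
move=> oA us Ax bu.
have ls := smooth_laplacian oA us; have es := smooth_euler oA us.
have rs := smoothM oA (smooth_rho oA) ls.
rewrite (laplacianD oA (smoothZ _ oA es)) //; last exact: smoothD oA rs (smoothZ _ oA us).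
rewrite (laplacianD oA rs (smoothZ _ oA us) Ax) !(laplacianZ _ oA _ Ax) //.
rewrite (laplacian_dotvvM oA ls Ax) (laplacian_euler oA us Ax).
rewrite [laplacian (laplacian u) x]bu; ring.
Qed.

(** For harmonic [w] the Laplacian of the product is a combination of [euler w] and [w], and the
    Euler operator preserves harmonicity. *)
Lemma bilaplacian_rhoM A w x : open A -> smooth_on A w -> A x ->
  (forall y, A y -> laplacian w y = 0) ->
  bilaplacian (fun y => (1 - dotv y y) * w y) x = 0.
Proof.
move=> oA ws Ax hw.
have es := smooth_euler oA ws.
have -> : bilaplacian (fun y => (1 - dotv y y) * w y) x =
    laplacian (fun y => (-4) * euler w y + (- 2 * n.+1%:R) * w y) x.
  apply: (eq_laplacian oA Ax) => y Ay.
  by rewrite (laplacian_dotvvM oA ws Ay) hw //; ring.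
rewrite (laplacianD oA (smoothZ _ oA es) (smoothZ _ oA ws) Ax) !(laplacianZ _ oA _ Ax) //.
rewrite (laplacian_euler oA ws Ax) hw //.
have -> : euler (laplacian w) x = euler (fun=> 0 : R) x by exact: eq_euler hw.
by rewrite euler_cst; ring.
Qed.

End Laplacian.

(** * Maximum principles on the ball *)

Section MaximumPrinciple.
Context {R : realType} {n : nat}.
Local Notation V := 'rV[R]_n.+1.
Implicit Types (A : set V) (u w : V -> R) (x y : V) (i j : 'I_n.+1) (k : nat).
Local Notation pd i u := ('D_('e_i) u).
Local Notation ball := (@unit_ball R n.+1).
Local Notation cball := (@unit_cball R n.+1).
Local Notation sphere := (@unit_sphere R n.+1).

(** * Euclidean inner product, ball and sphere *)

Lemma dotvv_ge0 d (x : 'rV[R]_d) : 0 <= dotv x x.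
Proof. by apply: sumr_ge0 => i _; rewrite -expr2 sqr_ge0. Qed.

Lemma dotvZl d (c : R) (x y : 'rV[R]_d) : dotv (c *: x) y = c * dotv x y.
Proof. by rewrite /dotv mulr_sumr; apply: eq_bigr => i _; rewrite !mxE mulrA. Qed.

Lemma dotvZr d (c : R) (x y : 'rV[R]_d) : dotv x (c *: y) = c * dotv x y.
Proof. by rewrite /dotv mulr_sumr; apply: eq_bigr => i _; rewrite !mxE; ring. Qed.

Lemma dotvBB d (x y : 'rV[R]_d) :
  dotv (x - y) (x - y) = dotv x x - 2 * dotv x y + dotv y y.
Proof.
rewrite /dotv mulr_sumr -sumrB -big_split /=; apply: eq_bigr => i _.
by rewrite !mxE; ring.
Qed.

Lemma dotvv_eq0 d (x : 'rV[R]_d) : dotv x x = 0 -> x = 0.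
Proof.
move=> /eqP; rewrite psumr_eq0 => [/allP H|i _]; last by rewrite -expr2 sqr_ge0.
apply/rowP => i; rewrite mxE; have := H i (mem_index_enum _).
by rewrite -expr2 sqrf_eq0 => /eqP.
Qed.

Lemma enorm_sqr d (x : 'rV[R]_d) : enorm x ^+ 2 = dotv x x.
Proof. by rewrite sqr_sqrtr // dotvv_ge0. Qed.

Lemma unit_ballE x : ball x <-> dotv x x < 1.
Proof. by rewrite /unit_ball /= -enorm_sqr expr_lt1 // sqrtr_ge0. Qed.

Lemma unit_cballE x : cball x <-> dotv x x <= 1.
Proof. by rewrite /unit_cball /= -enorm_sqr expr_le1 // sqrtr_ge0. Qed.

Lemma unit_sphereE x : sphere x <-> dotv x x = 1.
Proof.
rewrite /unit_sphere /= -enorm_sqr; split => [->|/eqP]; first by rewrite expr1n.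
by rewrite sqrf_eq1 => /orP[/eqP //|/eqP E]; have := sqrtr_ge0 (dotv x x); rewrite -/(enorm x) E; lra.
Qed.

Lemma ball_cball x : ball x -> cball x.
Proof. by rewrite unit_ballE unit_cballE => /ltW. Qed.

Lemma cball_sphere x : cball x -> ~ ball x -> sphere x.
Proof.
rewrite unit_cballE unit_ballE unit_sphereE => xc /negP; rewrite -leNgt => x1.
by apply/eqP; rewrite eq_le xc.
Qed.

Lemma continuous_dotvv : continuous (fun x : V => dotv x x).
Proof.
by move=> x; apply: (smooth_continuous (smooth_dotvv (@openT V))).
Qed.

Lemma open_ball : open ball.
Proof.
have -> : ball = (fun x : V => dotv x x) @^-1` [set t | t < 1].
  by apply/seteqP; split => x; rewrite unit_ballE.
by apply: open_comp => [x _|]; [exact: continuous_dotvv|exact: open_lt].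
Qed.

Lemma compact_dotvv_le (r : R) : compact [set x : V | dotv x x <= r].
Proof.
apply: bounded_closed_compact.
  (* The library norm is the sup norm, so coordinates are bounded one by one; a square at most [r]
     forces an absolute value at most [1 + r]. *)
  exists (1 + r); split => [|M Mr x /= xr]; first exact: num_real.
  apply: le_trans (ltW Mr); rewrite /Num.norm /= mx_normrE; apply/bigmax_leP.
  split => [|[a b] _ /=]; first by rewrite addr_ge0 // (le_trans (dotvv_ge0 x)).
  have xb : (x a b) ^+ 2 <= r.
    apply: le_trans xr; rewrite (ord1 a) /dotv (bigD1 b) //= -expr2 lerDl.
    by apply: sumr_ge0 => i _; rewrite -expr2 sqr_ge0.
  have := sqr_ge0 (x a b - 1); have := sqr_ge0 (x a b + 1).
  by move: xb; rewrite !expr2 ler_norml => *; apply/andP; split; nra.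
have -> : [set x : V | dotv x x <= r] = (fun x : V => dotv x x) @^-1` [set t | t <= r] by [].
by apply: closed_comp => [x _|]; [exact: continuous_dotvv|exact: closed_le].
Qed.

(** A uniform limit taken from inside the ball, because a quotient by [1 - dotv x x] has no
    meaningful value on the sphere. *)
Definition vanishes_at_boundary (f : V -> R) := forall e : R, 0 < e ->
  exists2 r : R, r < 1 & forall x, ball x -> r <= dotv x x -> `|f x| <= e.

(** Near the sphere [f] is at most [f x0 / 2], so its maximum over a closed concentric ball large
    enough to contain [x0] is a maximum over the whole open ball. *)
Lemma ball_max (f : V -> R) x0 : (forall x, ball x -> {for x, continuous f}) ->
  vanishes_at_boundary f -> ball x0 -> 0 < f x0 ->
  exists x1, [/\ ball x1, 0 < f x1 & forall y, ball y -> f y <= f x1].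
Proof.
move=> fc fv x0b f0.
have [r r1 fr] := fv _ (divr_gt0 f0 (ltr0Sn R 1)).
pose K := [set x : V | dotv x x <= Num.max r (dotv x0 x0)].
have K1 x : K x -> ball x.
  move=> /= Kx; apply/unit_ballE; apply: le_lt_trans Kx _.
  by rewrite gt_max r1; exact/unit_ballE.
have Kx0 : K x0 by rewrite /K /= le_max lexx orbT.
have [||| x1] := @EVT_max_rV R n.+1 f K; first by exists x0.
- exact: compact_dotvv_le.
- by apply/continuous_in_subspaceT => x; rewrite inE => /K1 /fc.
rewrite inE => Kx1 fmax; have fx01 : f x0 <= f x1 by apply: fmax; rewrite inE.
exists x1; split; [exact: K1|exact: lt_le_trans fx01|] => y yb.
have [Ky|] := pselect (K y); first by apply: fmax; rewrite inE.
rewrite /K /= => /negP; rewrite -ltNge gt_max => /andP[/ltW yr _].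
have := fr _ yb yr; rewrite ler_norml => /andP[_ fy].
by apply: le_trans fx01; lra.
Qed.

Lemma derive_at_max u x : smooth_on ball u -> ball x ->
  (forall y, ball y -> u y <= u x) ->
  (forall i, pd i u x = 0) /\ laplacian u x <= 0.
Proof.
move=> us xb umax.
suff H i : pd i u x = 0 /\ pd i (pd i u) x <= 0.
  by split => [i|]; [case: (H i)|apply: sumr_le0 => i _; case: (H i)].
have [d d0 H] := open_norm_ball open_ball xb.
pose N : R := `|'e_i : V| + 1; have N0 : 0 < N by rewrite ltr_wpDl.
have sb (s : R) : `|s| < d / N -> ball (s *: 'e_i + x).
  rewrite ltr_pdivlMr // => sd; apply: H.
  rewrite opprD addrCA subrr addr0 normrN normrZ; apply: le_lt_trans sd.
  by rewrite ler_wpM2l // lerDl.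
have := @snd_derive_at_max _ (fun s => u (s *: 'e_i + x))
  (fun s => pd i u (s *: 'e_i + x)) (pd i (pd i u) x) (d / N) (divr_gt0 d0 N0).
rewrite !scale0r !add0r; apply.
- move=> s /sb sxb; apply: is_derive_line; exact: smooth_derivable us sxb.
- have := @is_derive_line _ _ (pd i u) x 'e_i 0; rewrite scale0r add0r; apply.
  exact: smooth_derivable (smooth_pd i us) xb.
- by move=> s /sb /umax.
Qed.

Lemma harmonic_le0 u : smooth_on ball u -> (forall x, ball x -> laplacian u x = 0) ->
  vanishes_at_boundary u -> forall x, ball x -> u x <= 0.
Proof.
move=> us hu uv x xb; rewrite leNgt; apply/negP => ux0.
have oB := open_ball; have rs := smooth_rho oB.
(* The added term makes the Laplacian strictly positive, equal to [u x] times n + 1. It vanishes at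
   the boundary and is small enough to leave [f x] positive. *)
pose f y := u y + (- (u x / 2)) * (1 - dotv y y).
have fs : smooth_on ball f by apply: smoothD => //; exact: smoothZ.
have [||||x1 [x1b _ fmax]] := @ball_max f x.
- by move=> y; exact: smooth_continuous fs.
- move=> e e0; have [r r1 ur] := uv _ (divr_gt0 e0 (ltr0Sn R 1)).
  exists (Num.max r (1 - e / u x)).
    by rewrite gt_max r1 /= gtrBl divr_gt0.
  move=> y yb; rewrite ge_max => /andP[/(ur _ yb) uy].
  rewrite lerBlDr -lerBlDl ler_pdivlMr // => dy.
  have dy1 : dotv y y < 1 by exact/unit_ballE.
  by move: uy; rewrite /f !ler_norml => /andP[? ?]; apply/andP; split; nra.
- exact: xb.
- by have := dotvv_ge0 x; rewrite /f; nra.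
have [_] := derive_at_max fs x1b fmax.
rewrite (laplacianD oB us (smoothZ _ oB rs) x1b) hu // (laplacianZ _ oB rs x1b).
have -> : laplacian (fun y => 1 - dotv y y) x1 = laplacian (fun y => (1 - dotv y y) * 1) x1.
  by apply: (eq_laplacian oB x1b) => y _; rewrite mulr1.
rewrite (laplacian_dotvvM oB (smooth_cst 1 oB) x1b) laplacian_cst euler_cst.
have : 0 < n.+1%:R :> R by rewrite ltr0Sn.
by move: (n.+1%:R : R) (u x) ux0 => N a a0 N0; rewrite leNgt => /negP; apply; nra.
Qed.

(* In terms of [p = u / (1 - |x|^2)] the equation [almansi u = 0] reads
   [(1 - |x|^2)^2 * laplacian p = 8 * p], which forbids a positive maximum. *)
Lemma almansi_eq0_le0 u : smooth_on ball u -> (forall x, ball x -> almansi u x = 0) ->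
  vanishes_at_boundary (fun x => u x / (1 - dotv x x)) ->
  forall x, ball x -> u x <= 0.
Proof.
move=> us au uv x xb; rewrite leNgt; apply/negP => ux0.
have oB := open_ball; have rs := smooth_rho oB.
have rho0 y : ball y -> 0 < 1 - dotv y y by rewrite unit_ballE subr_gt0.
have [||||x1 [x1b]] := @ball_max (fun x => u x / (1 - dotv x x)) x.
- move=> y yb; apply: continuousM; first exact: smooth_continuous us yb.
  by apply: continuousV; [rewrite gt_eqF // rho0|exact: smooth_continuous rs yb].
- exact: uv.
- exact: xb.
- by rewrite divr_gt0 // rho0.
set M := u x1 / _ => M0 Mmax.
have uM : u x1 = M * (1 - dotv x1 x1) by rewrite /M divfK // gt_eqF // rho0.
move: M uM M0 Mmax => M uM M0 Mmax.
(* This avoids differentiating the quotient: [f] is nonpositive on the ball and is 0 at [x1], so the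
   maximum conditions on [f] give the needed information on [u]. *)
pose f y := u y + (- M) * (1 - dotv y y).
have fs : smooth_on ball f by apply: smoothD => //; exact: smoothZ.
have [|g0 l0] := derive_at_max fs x1b.
  move=> y yb; have := Mmax y yb; rewrite ler_pdivrMr ?rho0 // /f uM.
  by rewrite -subr_ge0 => h; rewrite -subr_ge0; nra.
have e1 : euler (fun y => 1 - dotv y y) x1 = - 2 * dotv x1 x1.
  have -> : euler (fun y => 1 - dotv y y) x1 = euler (fun y => 1 + (-1) * dotv y y) x1.
    by apply: (eq_euler oB x1b) => y _; rewrite mulN1r.
  have ds := smooth_dotvv oB.
  rewrite (eulerD (smooth_cst 1 oB) (smoothZ _ oB ds) x1b) (eulerZ _ oB ds x1b).
  by rewrite euler_cst euler_dotvv; ring.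
have l1 : laplacian (fun y => 1 - dotv y y) x1 = - 2 * n.+1%:R.
  have -> : laplacian (fun y => 1 - dotv y y) x1 = laplacian (fun y => (1 - dotv y y) * 1) x1.
    by apply: (eq_laplacian oB x1b) => y _; rewrite mulr1.
  rewrite (laplacian_dotvvM oB (smooth_cst 1 oB) x1b) laplacian_cst euler_cst; ring.
have eu : euler u x1 = - 2 * M * dotv x1 x1.
  have : euler f x1 = 0 by rewrite /euler big1 // => i _; rewrite g0 mulr0.
  rewrite (eulerD us (smoothZ _ oB rs) x1b) (eulerZ _ oB rs x1b) e1.
  by move: (euler u x1) (dotv x1 x1) => a b h; clear -h; lra.
have lu : laplacian u x1 <= - 2 * M * n.+1%:R.
  move: l0; rewrite (laplacianD oB us (smoothZ _ oB rs) x1b) (laplacianZ _ oB rs x1b) l1.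
  by move: (laplacian u x1) (n.+1%:R : R) => a b h; clear -h; lra.
(* Inserting the values at [x1] bounds [almansi u x1] above by [- 8 * M], which is negative. *)
have := au _ x1b; rewrite /almansi eu uM.
have rlu : (1 - dotv x1 x1) * laplacian u x1 <= (1 - dotv x1 x1) * (- 2 * M * n.+1%:R).
  by rewrite ler_wpM2l // ltW // rho0.
move: rlu; move: (laplacian u x1) (dotv x1 x1) (n.+1%:R : R) M0 => L D N M0 h1 h2.
clear -M0 h1 h2; lra.
Qed.

End MaximumPrinciple.

(** * Boundary behaviour and uniqueness *)

Section Boundary.
Context {R : realType} {n : nat}.
Local Notation V := 'rV[R]_n.+1.
Implicit Types (A : set V) (u v w : V -> R) (x y : V) (i j : 'I_n.+1) (k : nat).
Local Notation pd i u := ('D_('e_i) u).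
Local Notation ball := (@unit_ball R n.+1).
Local Notation cball := (@unit_cball R n.+1).
Local Notation sphere := (@unit_sphere R n.+1).

Lemma within_cball u x (e : R) : {within cball, continuous u} -> cball x -> 0 < e ->
  \forall y \near x, cball y -> `|u x - u y| < e.
Proof.
by move=> /subspace_continuousP uc xc e0; have /cvgrPdist_lt /(_ e e0) := uc x xc.
Qed.

Lemma within_cballD u w : {within cball, continuous u} ->
  {within cball, continuous w} -> {within cball, continuous (fun x => u x + w x)}.
Proof. by move=> uc wc x; apply: continuousD; [exact: uc|exact: wc]. Qed.

Lemma within_cballM u w : {within cball, continuous u} ->
  {within cball, continuous w} -> {within cball, continuous (fun x => u x * w x)}.
Proof. by move=> uc wc x; apply: continuousM; [exact: uc|exact: wc]. Qed.

Lemma within_cball_sum (I : Type) (r : seq I) (f : I -> V -> R) :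
  (forall a, {within cball, continuous (f a)}) ->
  {within cball, continuous (fun x => \sum_(a <- r) f a x)}.
Proof.
move=> fc; elim: r => [|a r IH].
  under [X in continuous X]eq_fun do rewrite big_nil.
  by apply: continuous_subspaceT; exact: cst_continuous.
under [X in continuous X]eq_fun do rewrite big_cons.
exact: within_cballD.
Qed.

Lemma within_cball_smooth A u : cball `<=` A -> smooth_on A u ->
  {within cball, continuous u}.
Proof.
move=> cA us; apply: continuous_in_subspaceT => x; rewrite inE => /cA.
exact: smooth_continuous.
Qed.

(** Compactness of the closed ball makes the estimate uniform. Near an interior point the condition
    [r <= dotv x x] fails once [r] is close to 1; near a point of the sphere, continuity of [g]
    applies. *)
Lemma vanishes_within f (g : V -> R) : {within cball, continuous g} ->
  (forall x, sphere x -> g x = 0) -> (forall x, ball x -> g x = f x) ->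
  vanishes_at_boundary f.
Proof.
move=> gc g0 gf e e0.
have cc : compact cball.
  have -> : cball = [set x : V | dotv x x <= 1].
    by apply/seteqP; split => x; rewrite unit_cballE.
  exact: compact_dotvv_le.
move/compact_near_coveringP/near_covering_withinP: cc.
move=> /(_ R (at_left (1 : R)) (fun r x => r <= dotv x x -> `|g x| <= e)).
have H x : cball x -> \forall x' \near x & r \near at_left (1 : R),
    cball x' -> r <= dotv x' x' -> `|g x'| <= e.
  move=> xc; have [xb|/(cball_sphere xc) xs] := pselect (ball x).
    pose m := (1 + dotv x x) / 2.
    have xm : dotv x x < m.
      by move: xb => /unit_ballE; rewrite /m; move: (dotv x x) => a; lra.
    have m1 : m < 1.
      by move: xb => /unit_ballE; rewrite /m; move: (dotv x x) => a; lra.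
    near=> y r => /= _.
    have ym : dotv y y < m.
      near: y; have := @continuous_dotvv R n x; move=> /cvgr_lt; exact.
    have rm : m < r by near: r; exact: nbhs_left_gt.
    by rewrite leNgt (lt_trans ym rm).
  near=> y r => /= yc _.
  have : cball y -> `|g x - g y| < e by near: y; exact: within_cball.
  by move=> /(_ yc); rewrite (g0 _ xs) sub0r normrN => /ltW.
move=> /(_ _ H) h; near (at_left (1 : R)) => r; exists r.
  by near: r; exact: nbhs_left_lt.
by move=> x xb; rewrite -gf //; apply: (near h r) => //; exact: ball_cball.
Unshelve. all: by end_near. Qed.

Lemma within_radial v x (a b t : R) : {within cball, continuous v} ->
  (forall t, a <= t <= b -> cball (t *: x)) ->
  {within `[a, b], continuous (fun t => v (t *: x))}.
Proof.
move=> /subspace_continuousP vc tx; apply/subspace_continuousP => s /= sab.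
apply: cvg_comp (vc (s *: x) _); last by apply: tx; rewrite in_itv in sab.
move=> B /= wB; have := @scalel_continuous _ _ x s _ wB.
rewrite !nbhs_simpl /=; apply: filterS => r /= Br rab; apply: Br.
by apply: tx; rewrite in_itv in rab.
Qed.

(** The endpoint [b *: x] may lie on the sphere, where only continuity of [v] from inside is
    available; derivatives are taken strictly between the endpoints. *)
Lemma radial_MVT v x (a b : R) : {within cball, continuous v} -> smooth_on ball v ->
  0 <= a -> a < b -> b ^+ 2 * dotv x x <= 1 ->
  exists2 c, a < c < b &
    v (b *: x) - v (a *: x) = (\sum_i x 0 i * pd i v (c *: x)) * (b - a).
Proof.
move=> vc vs a0 ab bx.
have inb t : a < t < b -> ball (t *: x).
  move=> /andP[at_ tb]; apply/unit_ballE; rewrite dotvZl dotvZr mulrA -expr2.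
  have [x0|x0] := ltP 0 (dotv x x); last first.
    by rewrite (le_lt_trans _ ltr01) // pmulr_rle0 // exprn_gt0 // (le_lt_trans a0).
  apply: lt_le_trans bx; rewrite ltr_pM2r // ltr_pXn2r // nnegrE; lra.
have inc t : a <= t <= b -> cball (t *: x).
  move=> /andP[at_ tb]; apply/unit_cballE; rewrite dotvZl dotvZr mulrA -expr2.
  apply: le_trans bx; rewrite ler_wpM2r ?dotvv_ge0 // ler_pXn2r // nnegrE; lra.
have [||c] := @MVT _ (fun t => v (t *: x))
  (fun t => \sum_i x 0 i * pd i v (t *: x)) a b ab.
- move=> t; rewrite in_itv /= => /inb tx.
  have [D1 D2] := is_derive_dir x open_ball vs tx.
  rewrite -D2; have := @is_derive_line _ _ v 0 x t; rewrite addr0.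
  under [X in is_derive _ _ X _]eq_fun do rewrite addr0.
  by apply.
- exact: within_radial.
by rewrite in_itv /=; exists c.
Qed.

(** Each one-sided difference quotient is a radial derivative at some interior point [c *: x]. There
    the partials agree with the extensions [g i], whose continuity gives the limit as [c] tends to
    1. *)
Lemma normal_derivativeE v (g : 'I_n.+1 -> V -> R) x :
  {within cball, continuous v} -> smooth_on ball v ->
  (forall i, {within cball, continuous (g i)}) ->
  (forall i y, ball y -> g i y = pd i v y) -> sphere x ->
  normal_derivative v x = \sum_i x 0 i * g i x.
Proof.
move=> vc vs gc gv xs; have x1 : dotv x x = 1 by exact/unit_sphereE.
pose G y := \sum_i x 0 i * g i y.
have Gc : {within cball, continuous G}.
  apply: within_cball_sum => i; apply: within_cballM => //.
  by apply: continuous_subspaceT; exact: cst_continuous.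
apply/cvg_lim => //; apply/cvgrPdist_lt => e e0.
have xc : cball x by apply/unit_cballE; rewrite x1.
have /nbhs_normP[d /= d0 Hd] := within_cball Gc xc e0.
near=> h.
have h0 : h < 0 by near: h; exact: nbhs_left_lt.
have h1 : -1 < h by near: h; apply: nbhs_left_gt; rewrite ltrN10.
have hd : - (d / (`|x| + 1)) < h.
  by near: h; apply: nbhs_left_gt; rewrite oppr_lt0 divr_gt0 // ltr_wpDl.
have [|||c /andP[c1 c2]] := @radial_MVT v x (1 + h) 1 vc vs.
- by lra.
- by lra.
- by rewrite x1 expr1n mulr1.
rewrite scale1r scalerDl scale1r => E.
have cb : ball (c *: x).
  apply/unit_ballE; rewrite dotvZl dotvZr x1 mulr1 -expr2 expr_lt1 //; lra.
have -> : h^-1 * (v (x + h *: x) - v x) = G (c *: x).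
  rewrite -[v (x + _) - _]opprB E /G.
  under [in RHS]eq_bigr do rewrite gv //.
  field; lra.
apply: Hd; last exact: ball_cball.
rewrite /ball_ /= -[X in X - _]scale1r -scalerBl normrZ.
have N0 : 0 < `|x| + 1 by rewrite ltr_wpDl.
have {}hd : `|1 - c| * (`|x| + 1) < d.
  rewrite -ltr_pdivlMr // ltr_norml; lra.
by apply: le_lt_trans hd; rewrite ler_wpM2l // lerDl.
Unshelve. all: by end_near. Qed.

(* Mean value theorem along the radius, from [x] to [x / |x|]. *)
Lemma vanishes_quotient u : {within cball, continuous u} -> smooth_on ball u ->
  (forall x, sphere x -> u x = 0) -> vanishes_at_boundary (euler u) ->
  vanishes_at_boundary (fun x => u x / (1 - dotv x x)).
Proof.
move=> uc us u0 ev e e0; have [r r1 re] := ev _ (divr_gt0 e0 (ltr0Sn R 1)).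
(* The bound 1/4 gives [1 / 2 <= m], hence [m^-1 - 1 <= 2 * (1 - m)]; this 2 is absorbed by the
   choice of [e / 2] above. *)
exists (Num.max r (1 / 4)); first by rewrite gt_max r1 /=; lra.
move=> x xb; rewrite ge_max => /andP[rx x4].
have x1 : dotv x x < 1 by exact/unit_ballE.
pose m := enorm x; have m2 : dotv x x = m ^+ 2 by rewrite enorm_sqr.
have m0 : 0 <= m := sqrtr_ge0 _.
have mh : 1 / 2 <= m by rewrite leNgt; apply/negP => ?; nra.
have m1 : m < 1 by rewrite ltNge; apply/negP => ?; nra.
have [|||c /andP[c1 c2]] := @radial_MVT u x 1 m^-1 uc us.
- by [].
- by rewrite invf_gt1 //; lra.
- by rewrite m2 -exprMn mulVf ?expr1n // gt_eqF //; lra.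
have cx : dotv (c *: x) (c *: x) = c ^+ 2 * dotv x x.
  by rewrite dotvZl dotvZr mulrA -expr2.
have cb : ball (c *: x).
  apply/unit_ballE; rewrite cx m2 -exprMn expr_lt1 //; last by nra.
  by move: c2; rewrite -ltr_pdivlMr ?div1r //; lra.
have -> : u (m^-1 *: x) = 0.
  apply: u0; apply/unit_sphereE; rewrite dotvZl dotvZr m2; field; lra.
have -> : \sum_i x 0 i * pd i u (c *: x) = c^-1 * euler u (c *: x).
  rewrite /euler mulr_sumr; apply: eq_bigr => i _; rewrite !mxE; field; lra.
rewrite scale1r sub0r => E.
have ec : `|euler u (c *: x)| <= e / 2.
  apply: re => //; apply: le_trans rx _; rewrite cx ler_peMl ?dotvv_ge0 //.
  by rewrite expr_ge1 //; lra.
have ci : 0 < c^-1 <= 1 by rewrite invr_gt0 invf_le1; lra.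
have mi : (m^-1 - 1) * m = 1 - m by field; lra.
have mi0 : 0 < m^-1 - 1 by rewrite subr_gt0 invf_gt1 //; lra.
have -> : u x = - (c^-1 * euler u (c *: x) * (m^-1 - 1)) by rewrite -E opprK.
rewrite m2 normrM normrV ?unitfE; last by rewrite gt_eqF //; nra.
rewrite [`|1 - _|]gtr0_norm; last by nra.
rewrite ler_pdivrMr; last by nra.
rewrite normrN !normrM (gtr0_norm mi0) (gtr0_norm (proj1 (andP ci))).
have -> : e * (1 - m ^+ 2) = e / 2 * (2 * (1 - m)) * (1 + m) by field.
have mi2 : m^-1 - 1 <= 2 * (1 - m) by rewrite -mi; clear -mi0 mh; nra.
apply: (@le_trans _ _ (e / 2 * (2 * (1 - m)))).
  apply: ler_pM => //; [by rewrite mulr_ge0 //; lra|by lra|].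
  rewrite -[leRHS]mul1r ler_pM //; lra.
by rewrite ler_peMr //; [rewrite mulr_ge0 //; lra|lra].
Qed.

(** The functions [g i] and [l] carry the gradient and the Laplacian up to the sphere: the former
    makes the radial derivative vanish there, the latter keeps the Laplacian bounded, so that its
    product with 1 - |x|^2 vanishes too. Each maximum principle is applied to a function and to its
    opposite. *)
Lemma clamped_biharmonic_eq0 u (g : 'I_n.+1 -> V -> R) (l : V -> R) :
  {within cball, continuous u} -> smooth_on ball u ->
  (forall i, {within cball, continuous (g i)}) ->
  (forall i x, ball x -> g i x = pd i u x) ->
  {within cball, continuous l} -> (forall x, ball x -> l x = laplacian u x) ->
  (forall x, ball x -> bilaplacian u x = 0) ->
  (forall x, sphere x -> u x = 0) ->
  (forall x, sphere x -> \sum_i x 0 i * g i x = 0) ->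
  forall x, ball x -> u x = 0.
Proof.
move=> uc us gc gu lc lu bu u0 g0.
have oB := @open_ball R n.
have cst (c : R) : {within cball, continuous (fun=> c : R)}.
  by apply: continuous_subspaceT; exact: cst_continuous.
have Ec : {within cball, continuous (fun x : V => \sum_i x 0 i * g i x)}.
  apply: within_cball_sum => i; apply: within_cballM => //.
  by apply: continuous_subspaceT; exact: coord_continuous.
have Eu x : ball x -> \sum_i x 0 i * g i x = euler u x.
  by move=> xb; apply: eq_bigr => i _; rewrite gu.
have ev : vanishes_at_boundary (euler u) by exact: vanishes_within Ec g0 Eu.
have rc : {within cball, continuous (fun x : V => 1 - dotv x x)}.
  apply: (@within_cball_smooth setT) => //; exact: smooth_rho openT.
have av : vanishes_at_boundary (almansi u).
  apply: (@vanishes_within _ (fun x => 4 * (\sum_i x 0 i * g i x) +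
      ((1 - dotv x x) * l x + (2 * n.+1%:R - 8) * u x))).
  - by apply: within_cballD; [|apply: within_cballD]; exact: within_cballM.
  - move=> x xs; rewrite g0 // u0 //; move/unit_sphereE: xs => ->.
    by rewrite subrr mul0r !mulr0 !addr0.
  - by move=> x xb; rewrite Eu // lu.
have as_ := smooth_almansi oB us.
have al x : ball x -> laplacian (almansi u) x = 0.
  by move=> xb; apply: (laplacian_almansi oB us xb); exact: bu.
have oppv (f : V -> R) : vanishes_at_boundary f ->
    vanishes_at_boundary (fun x => -1 * f x).
  move=> fv e /fv [r r1 fr]; exists r => // x xb rx.
  by rewrite mulN1r normrN; exact: fr.
have a0 x : ball x -> almansi u x = 0.
  move=> xb; apply/eqP; rewrite eq_le (harmonic_le0 as_ al av xb) /=.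
  rewrite -oppr_le0 -mulN1r; apply: (harmonic_le0 (smoothZ (-1) oB as_)) xb.
    by move=> y yb; rewrite (laplacianZ _ oB as_ yb) al // mulr0.
  exact: oppv.
have qv := vanishes_quotient uc us u0 ev.
move=> x xb; apply/eqP; rewrite eq_le (almansi_eq0_le0 us a0 qv xb) /=.
rewrite -oppr_le0 -mulN1r; apply: (almansi_eq0_le0 (smoothZ (-1) oB us)) xb.
  move=> y yb; rewrite /almansi (eulerZ _ oB us yb) (laplacianZ _ oB us yb).
  have := a0 _ yb; rewrite /almansi.
  move: (euler u y) (laplacian u y) (u y) (dotv y y) (2 * _ - 8) => a b c d f h.
  by rewrite -[RHS](mulr0 (-1)) -h; ring.
by move=> e e0; have [r r1 H] := oppv _ qv e e0; exists r => // y yb ry; rewrite -mulrA H.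
Qed.

Lemma partials_smooth v s : smooth_on_ball v -> smooth_on ball (partials s v).
Proof.
move=> vs k; elim: k s => [|k IH] s; split => //.
- by move=> x /(vs s) [].
- by move=> x /(vs s) [].
split => [i x /(vs s) []//|i]; exact: (IH (i :: s)).
Qed.

(** The two functions enter asymmetrically: the closed form [w] is smooth across the sphere, so its
    normal derivative is simply [euler w], whereas that of [v] is a one-sided limit. *)
Lemma clamped_biharmonic_unique A v w : open A -> cball `<=` A ->
  smooth_on_cball v -> smooth_on A w ->
  (forall x, ball x -> bilaplacian v x = 0) ->
  (forall x, ball x -> bilaplacian w x = 0) ->
  (forall x, sphere x -> v x = w x) ->
  (forall x, sphere x -> normal_derivative v x = euler w x) ->
  forall x, cball x -> v x = w x.
Proof.
move=> oA cA [vc vs vext] ws bv bw vw nvw.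
have oB := @open_ball R n.
have wB : smooth_on ball w by apply: sub_smooth ws => x /ball_cball /cA.
have vB : smooth_on ball v := partials_smooth [::] vs.
have nB : smooth_on ball (fun x => -1 * w x) by exact: smoothZ.
have nA : smooth_on A (fun x => -1 * w x) by exact: smoothZ.
have wc f : smooth_on A f -> {within cball, continuous f}.
  exact: within_cball_smooth.
(* Of all the extensions granted by [vext], those of the first and of the pure second partials are
   chosen. *)
have [g gP] := choice (fun i => vext [:: i]).
have [l lP] := choice (fun i => vext [:: i; i]).
have gc i := (gP i).1; have gv i := (gP i).2.
pose u x := v x + -1 * w x.
have u0 : forall x, ball x -> u x = 0.
  apply: (@clamped_biharmonic_eq0 u (fun i x => g i x + -1 * pd i w x)
    (fun x => \sum_i l i x + -1 * laplacian w x)).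
  - by apply: within_cballD => //; exact: wc.
  - exact: smoothD.
  - move=> i; apply: within_cballD; first exact: gc.
    by apply: wc; apply: smoothZ => //; exact: smooth_pd.
  - move=> i x xb; rewrite gv //.
    have d1 : derivable (fun=> -1 : R) x 'e_i by exact: derivable_cst.
    have dw : derivable w x 'e_i by exact: smooth_derivable wB xb.
    rewrite (@pdD _ _ v); [|exact: smooth_derivable vB xb|exact: smooth_derivable nB xb].
    by rewrite (pdM d1 dw) pd_cst mulr0 addr0.
  - apply: within_cballD; first by apply: within_cball_sum => i; exact: (lP i).1.
    by apply: wc; apply: smoothZ => //; exact: smooth_laplacian.
  - move=> x xb; rewrite (laplacianD oB vB nB xb) (laplacianZ _ oB wB xb).
    by congr (_ + _); apply: eq_bigr => i _; exact: (lP i).2.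
  - move=> x xb; rewrite (bilaplacianD oB vB nB xb) (bilaplacianZ _ oB wB xb).
    by rewrite bv // bw // mulr0 addr0.
  - by move=> x xs; rewrite /u vw // mulN1r subrr.
  - move=> x xs; have := nvw x xs.
    rewrite (normal_derivativeE vc vB gc gv xs) => E.
    under eq_bigr do rewrite mulrDr mulrCA.
    by rewrite big_split /= E -mulr_sumr mulN1r subrr.
move=> x xc; have [xb|/(cball_sphere xc)] := pselect (ball x); last exact: vw.
by apply/eqP; rewrite -subr_eq0 -mulN1r; apply/eqP; exact: u0.
Qed.

End Boundary.

(** * Powers and logarithm of F^2 *)

Section Explicit.
Context {R : realType} {n : nat}.
Local Notation V := 'rV[R]_n.+1.
Implicit Types (A : set V) (u : V -> R) (x y z : V) (i j : 'I_n.+1).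
Local Notation pd i u := ('D_('e_i) u).
Local Notation ball := (@unit_ball R n.+1).
Local Notation cball := (@unit_cball R n.+1).
Local Notation sphere := (@unit_sphere R n.+1).

Lemma dotvC x y : dotv x y = dotv y x.
Proof. by apply: eq_bigr => i _; rewrite mulrC. Qed.

(** Here [f], [g], [h] stand for phi(u), phi'(u), phi''(u); the chain-rule hypotheses let one
    formula serve powers and the logarithm alike. *)
Lemma laplacian_comp A u (f g h : V -> R) x : open A -> smooth_on A u ->
  smooth_on A g ->
  (forall i y, A y -> pd i f y = g y * pd i u y) ->
  (forall i y, A y -> pd i g y = h y * pd i u y) -> A x ->
  laplacian f x = h x * (\sum_i pd i u x ^+ 2) + g x * laplacian u x.
Proof.
move=> oA us gs fg gh Ax; rewrite /laplacian !mulr_sumr -big_split /=.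
apply: eq_bigr => i _.
have -> : pd i (pd i f) x = pd i (fun y => g y * pd i u y) x.
  by apply: (eq_pd _ oA Ax) => y; exact: fg.
have dg : derivable g x 'e_i by exact: smooth_derivable gs Ax.
have ddu : derivable (pd i u) x 'e_i by exact: smooth_derivable (smooth_pd i us) Ax.
by rewrite (pdM dg ddu) gh // addrC; congr (_ + _); rewrite mulrCA expr2.
Qed.

Variable w : V.
Local Notation c := (dotv w w).
Hypothesis w1 : c < 1.

(** The square of [F] as a polynomial in [x], which removes the case distinction at 0 and is smooth
    everywhere. *)
Definition Fsqr x : R := 1 + (-2 * dotv x w + c * dotv x x).
Local Notation Q := Fsqr.
Local Notation A := [set x : V | 0 < Q x].

Lemma F_sqr x : F x w ^+ 2 = Q x.
Proof.
rewrite /F /Fsqr; case: eqP => [->|/eqP x0].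
  by rewrite expr1n -[0 : V](scale0r x) !dotvZl !mul0r !mulr0 !addr0.
have e0 : enorm x != 0.
  rewrite -sqrf_eq0 enorm_sqr; apply: contraNneq x0 => /dotvv_eq0 ->.
  by [].
rewrite enorm_sqr dotvBB !dotvZl !dotvZr -enorm_sqr.
by move: (enorm x) (dotv x w) (dotv w w) e0 => a b d a0; field.
Qed.

Lemma F_ge0 x : 0 <= F x w.
Proof. by rewrite /F; case: ifP => // _; exact: sqrtr_ge0. Qed.

Lemma smooth_Fsqr B : open B -> smooth_on B Q.
Proof.
move=> oB; apply: smoothD => //; first exact: smooth_cst.
by apply: smoothD => //; apply: smoothZ => //; [exact: smooth_dotv|exact: smooth_dotvv].
Qed.

Lemma open_Fsqr : open A.
Proof.
have -> : A = Q @^-1` [set t | 0 < t] by [].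
apply: open_comp => [x _|]; last exact: open_gt.
exact: smooth_continuous (smooth_Fsqr openT) _.
Qed.

Lemma cball_Fsqr : cball `<=` A.
Proof.
move=> x /unit_cballE x1 /=.
(* Inside the ball the second term is positive; on the sphere the first one is, because [w] is not
   on it. *)
have -> : Q x = dotv (x - w) (x - w) + (1 - dotv x x) * (1 - c).
  by rewrite dotvBB /Fsqr; ring.
have [x_1|x_1] := ltP (dotv x x) 1.
  by rewrite ltr_wpDl ?dotvv_ge0 // mulr_gt0 // subr_gt0.
have x11 : dotv x x = 1 by apply/eqP; rewrite eq_le x1.
rewrite x11 subrr mul0r addr0 lt_neqAle dotvv_ge0 andbT eq_sym.
apply: contraTneq w1 => /dotvv_eq0 /subr0_eq xw.
by rewrite -xw x11 ltxx.
Qed.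

Lemma pd_Fsqr i x : pd i Q x = -2 * w 0 i + 2 * c * x 0 i.
Proof.
have dT u : smooth_on setT u -> derivable u x 'e_i.
  by move=> us; exact: (@smooth_derivable _ _ setT).
have d0 := smooth_cst (1 : R) (@openT V).
have d1 := smooth_dotv w (@openT V); have d2 := smooth_dotvv (@openT V).
have z1 := smoothZ (-2) openT d1; have z2 := smoothZ c openT d2.
have c1 := dT _ (smooth_cst (-2 : R) openT); have c2 := dT _ (smooth_cst c openT).
rewrite (pdD (dT _ d0) (dT _ (smoothD openT z1 z2))) (pdD (dT _ z1) (dT _ z2)).
rewrite (pdM c1 (dT _ d1)) (pdM c2 (dT _ d2)) !pd_cst pd_dotv pd_dotvv; ring.
Qed.

Lemma sum_pd_Fsqr x : \sum_i pd i Q x ^+ 2 = 4 * c * Q x.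
Proof.
(* The coefficient [c] is abstracted to [k], so that unfolding [dotv] does not expand it into a
   sum. *)
have H (k : R) : \sum_i (-2 * w 0 i + 2 * k * x 0 i) ^+ 2 =
    4 * dotv w w + (-8 * k) * dotv x w + 4 * k ^+ 2 * dotv x x.
  rewrite /dotv !mulr_sumr -!big_split /=.
  by apply: eq_bigr => i _; ring.
by under eq_bigr do rewrite pd_Fsqr; rewrite H /Fsqr; ring.
Qed.

Lemma laplacian_Fsqr x : laplacian Q x = 2 * n.+1%:R * c.
Proof.
have d1 := smooth_dotv w (@openT V); have d2 := smooth_dotvv (@openT V).
have d0 := smooth_cst (1 : R) (@openT V).
have z1 := smoothZ (-2) openT d1; have z2 := smoothZ c openT d2.
rewrite (laplacianD openT d0 (smoothD openT z1 z2)) // (laplacianD openT z1 z2) //.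
rewrite (laplacianZ _ openT d1) // (laplacianZ _ openT d2) // laplacian_cst.
rewrite laplacian_dotvv.
have -> : laplacian (fun y => dotv y w) x = 0.
  rewrite /laplacian big1 // => i _.
  have -> : pd i (fun y => dotv y w) = (fun=> w 0 i) :> (V -> R).
    by apply/funext => y; rewrite pd_dotv.
  by rewrite pd_cst.
by ring.
Qed.

Lemma euler_Fsqr x : euler Q x = Q x - 1 + c * dotv x x.
Proof.
rewrite /euler; under eq_bigr do rewrite pd_Fsqr.
transitivity (-2 * dotv x w + 2 * c * dotv x x); last by rewrite /Fsqr; ring.
rewrite [dotv x w]/dotv [dotv x x]/dotv !mulr_sumr -big_split /=.
by apply: eq_bigr => i _; ring.
Qed.

Let oA := open_Fsqr.
Let Qs := smooth_Fsqr oA.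

Lemma pd_powR_Fsqr (a : R) i x : A x ->
  pd i (fun y => Q y `^ a) x = a * Q x `^ (a - 1) * pd i Q x.
Proof.
by move=> Ax; case: (is_derive_powR a Ax (smooth_derivable (i := i) Qs Ax)).
Qed.

Lemma smooth_powR_Fsqr (a : R) : smooth_on A (fun y => Q y `^ a).
Proof. exact: smooth_powR. Qed.

(** The factor [4 * (a - 1) + 2 * n.+1%:R] vanishes at a = 1 - d/2 with d = n + 1. Since Q = |w|^2
    |x - w/|w|^2|^2 for w nonzero, that power is a multiple of |x - w/|w|^2|^(2 - d), harmonic away
    from the point inverse to w. *)
Lemma laplacian_powR_Fsqr (a : R) x : A x ->
  laplacian (fun y => Q y `^ a) x =
    a * (4 * (a - 1) + 2 * n.+1%:R) * c * Q x `^ (a - 1).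
Proof.
move=> Ax; have sa := smooth_powR_Fsqr (a - 1).
rewrite (@laplacian_comp A Q _ (fun y => a * Q y `^ (a - 1))
  (fun y => a * ((a - 1) * Q y `^ (a - 1 - 1)))) //.
- rewrite sum_pd_Fsqr laplacian_Fsqr.
  have -> : Q x `^ (a - 1) = Q x `^ (a - 1 - 1) * Q x.
    rewrite -{3}(powRr1 (ltW Ax)) -powRD ?subrK //.
    by apply/implyP => _; rewrite gt_eqF.
  by move: (Q x `^ (a - 1 - 1)) (Q x) c (n.+1%:R : R) => p q d m; ring.
- exact: smoothZ.
- by move=> i y Ay; rewrite pd_powR_Fsqr.
- move=> i y Ay.
  have da : derivable (fun=> a : R) y 'e_i by exact: derivable_cst.
  have dq : derivable (fun z => Q z `^ (a - 1)) y 'e_i by exact: smooth_derivable sa Ay.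
  by rewrite (pdM da dq) pd_cst mulr0 addr0 pd_powR_Fsqr // !mulrA.
Qed.

Lemma euler_powR_Fsqr (a : R) x : A x ->
  euler (fun y => Q y `^ a) x = a * Q x `^ (a - 1) * euler Q x.
Proof.
move=> Ax; rewrite /euler mulr_sumr; apply: eq_bigr => i _.
by rewrite pd_powR_Fsqr // mulrCA.
Qed.

Lemma pd_ln_Fsqr i x : A x -> pd i (fun y => ln (Q y)) x = Q x `^ (-1) * pd i Q x.
Proof.
move=> Ax; rewrite powR_inv1 ?(ltW Ax) //.
by case: (is_derive_ln Ax (smooth_derivable (i := i) Qs Ax)).
Qed.

Lemma laplacian_ln_Fsqr x : A x ->
  laplacian (fun y => ln (Q y)) x = (2 * n.+1%:R - 4) * c * Q x `^ (-1).
Proof.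
move=> Ax.
rewrite (@laplacian_comp A Q _ (fun y => Q y `^ (-1)) (fun y => -1 * Q y `^ (-1 - 1))) //.
- rewrite sum_pd_Fsqr laplacian_Fsqr.
  have -> : Q x `^ (-1) = Q x `^ (-1 - 1) * Q x.
    rewrite -{3}(powRr1 (ltW Ax)) -powRD ?subrK //.
    by apply/implyP => _; rewrite gt_eqF.
  by move: (Q x `^ (-1 - 1)) (Q x) c (n.+1%:R : R) => p q d m; ring.
- exact: smooth_powR_Fsqr.
- by move=> i y Ay; rewrite pd_ln_Fsqr.
- by move=> i y Ay; rewrite pd_powR_Fsqr.
Qed.

Lemma euler_ln_Fsqr x : A x -> euler (fun y => ln (Q y)) x = Q x `^ (-1) * euler Q x.
Proof.
move=> Ax; rewrite /euler mulr_sumr; apply: eq_bigr => i _.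
by rewrite pd_ln_Fsqr // mulrCA.
Qed.

End Explicit.

(** * The explicit solutions *)

Section Solutions.
Context {R : realType} {n : nat}.
Local Notation V := 'rV[R]_n.+1.
Local Notation ball := (@unit_ball R n.+1).
Local Notation cball := (@unit_cball R n.+1).
Local Notation sphere := (@unit_sphere R n.+1).
Variable w : V.
Hypothesis w1 : dotv w w < 1.
Local Notation c := (dotv w w).
Local Notation Q := (Fsqr w).
Local Notation A := [set x : V | 0 < Q x].

Let oA : open A := open_Fsqr (w := w).
Let rs : smooth_on A (fun x : V => 1 - dotv x x) := smooth_rho oA.

Lemma euler_rhoM (h : V -> R) (x : V) : smooth_on A h -> A x -> sphere x ->
  euler (fun y => (1 - dotv y y) * h y) x = - 2 * h x.
Proof.
move=> hs Ax /unit_sphereE x1; rewrite (eulerM rs hs Ax) x1 subrr mul0r add0r.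
have ds := smooth_dotvv oA.
have -> : euler (fun y => 1 - dotv y y) x = euler (fun y => 1 + (-1) * dotv y y) x.
  by apply: (eq_euler oA Ax) => y _; rewrite mulN1r.
rewrite (eulerD (smooth_cst 1 oA) (smoothZ _ oA ds) Ax) (eulerZ _ oA ds Ax).
by rewrite euler_cst euler_dotvv x1; ring.
Qed.

Definition power_solution (K : R) (x : V) : R :=
  K * (Q x `^ ((3 - n%:R) / 2) + (n%:R - 3) * (1 - c) / 4 *
       ((1 - dotv x x) * Q x `^ ((3 - n%:R) / 2 - 1))).

Lemma smooth_power_solution K : smooth_on A (power_solution K).
Proof.
apply: smoothZ => //; apply: smoothD => //; first exact: smooth_powR_Fsqr.
by apply: smoothZ => //; apply: smoothM => //; exact: smooth_powR_Fsqr.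
Qed.

Lemma laplacian_powR_Fsqr_eq0 (x : V) : A x ->
  laplacian (fun y => Q y `^ ((3 - n%:R) / 2 - 1)) x = 0.
Proof.
move=> Ax; rewrite laplacian_powR_Fsqr // -(@natr1 R n).
have -> : 4 * ((3 - n%:R) / 2 - 1 - 1) + 2 * (n%:R + 1) = 0 :> R by field.
by rewrite mulr0 !mul0r.
Qed.

Lemma bilaplacian_power_solution K (x : V) : A x -> bilaplacian (power_solution K) x = 0.
Proof.
move=> Ax; set a := (3 - n%:R) / 2 : R.
have s1 := smooth_powR_Fsqr w a; have s2 := smooth_powR_Fsqr w (a - 1).
have s3 := smoothM oA rs s2.
have s4 := smoothZ ((n%:R - 3) * (1 - c) / 4) oA s3.
rewrite (bilaplacianZ _ oA (smoothD oA s1 s4) Ax) (bilaplacianD oA s1 s4 Ax).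
rewrite (bilaplacianZ _ oA s3 Ax) (bilaplacian_rhoM oA s2 Ax) ?mulr0 ?addr0; last first.
  by move=> y; exact: laplacian_powR_Fsqr_eq0.
have -> : bilaplacian (fun y => Q y `^ a) x =
    laplacian (fun y => a * (4 * (a - 1) + 2 * n.+1%:R) * c * Q y `^ (a - 1)) x.
  by apply: (eq_laplacian oA Ax) => y Ay; rewrite laplacian_powR_Fsqr.
by rewrite (laplacianZ _ oA s2 Ax) laplacian_powR_Fsqr_eq0 // !mulr0.
Qed.

Lemma power_solution_sphere K (x : V) : sphere x ->
  power_solution K x = K * Q x `^ ((3 - n%:R) / 2).
Proof.
by move=> /unit_sphereE x1; rewrite /power_solution x1 subrr mul0r mulr0 addr0.
Qed.

(** On the sphere [euler Q x] is [Q x - (1 - c)], so differentiating Q^a leaves an unwanted - a (1 -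
    c) Q^(a - 1). The coefficient [(n%:R - 3) * (1 - c) / 4] is the one for which the second term
    cancels it. *)
Lemma euler_power_solution K (x : V) : A x -> sphere x ->
  euler (power_solution K) x = - ((n%:R - 3) / 2) * (K * Q x `^ ((3 - n%:R) / 2)).
Proof.
move=> Ax xs; set a := (3 - n%:R) / 2 : R.
have s1 := smooth_powR_Fsqr w a; have s2 := smooth_powR_Fsqr w (a - 1).
have s3 := smoothM oA rs s2.
have s4 := smoothZ ((n%:R - 3) * (1 - c) / 4) oA s3.
rewrite (eulerZ _ oA (smoothD oA s1 s4) Ax) (eulerD s1 s4 Ax) (eulerZ _ oA s3 Ax).
rewrite (euler_rhoM s2 Ax xs) euler_powR_Fsqr // euler_Fsqr.
have -> : Q x `^ a = Q x `^ (a - 1) * Q x.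
  rewrite -{3}(powRr1 (ltW Ax)) -powRD ?subrK //.
  by apply/implyP => _; rewrite gt_eqF.
move/unit_sphereE: xs => ->; move: (Q x `^ (a - 1)) => p; rewrite /a.
by move: (Q x) c (n%:R : R) => q d m; field.
Qed.

Definition log_solution (K : R) (x : V) : R :=
  -1 * ln (Q x) + (2^-1 * ((1 - dotv x x) * ((1 - c) * Q x `^ (-1) + -1)) + K).

Let ls : smooth_on A (fun x => ln (Q x)).
Proof. by apply: smooth_ln => //; exact: smooth_Fsqr. Qed.

Let hs : smooth_on A (fun x => (1 - c) * Q x `^ (-1) + -1).
Proof.
apply: smoothD => //; last exact: smooth_cst.
by apply: smoothZ => //; exact: smooth_powR_Fsqr.
Qed.

Lemma smooth_log_solution K : smooth_on A (log_solution K).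
Proof.
apply: smoothD => //; first exact: smoothZ.
apply: smoothD => //; last exact: smooth_cst.
by apply: smoothZ => //; exact: smoothM.
Qed.

Lemma bilaplacian_log_solution K (x : V) : n = 3%N -> A x ->
  bilaplacian (log_solution K) x = 0.
Proof.
move=> n3 Ax.
have s1 := smooth_powR_Fsqr w (-1).
(* In dimension 4 the harmonic exponent 1 - d/2 is -1. *)
have hQ (y : V) : A y -> laplacian (fun y => Q y `^ (-1)) y = 0.
  move=> Ay; rewrite laplacian_powR_Fsqr //.
  have -> : n.+1%:R = 4 :> R by rewrite n3.
  by ring.
have c1 := smooth_cst (-1 : R) oA; have cK := smooth_cst K oA.
have s3 := smoothM oA rs hs; have s4 := smoothZ 2^-1 oA s3.
rewrite (bilaplacianD oA (smoothZ (-1) oA ls) (smoothD oA s4 cK) Ax).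
rewrite (bilaplacianD oA s4 cK Ax) (bilaplacianZ _ oA ls Ax) (bilaplacianZ _ oA s3 Ax).
rewrite (bilaplacian_rhoM oA hs Ax); last first.
  move=> y Ay; rewrite (laplacianD oA (smoothZ _ oA s1) c1 Ay) (laplacianZ _ oA s1 Ay).
  by rewrite hQ // laplacian_cst mulr0 addr0.
have -> : bilaplacian (fun y => ln (Q y)) x =
    laplacian (fun y => (2 * n.+1%:R - 4) * c * Q y `^ (-1)) x.
  by apply: (eq_laplacian oA Ax) => y Ay; rewrite laplacian_ln_Fsqr.
rewrite (laplacianZ _ oA s1 Ax) hQ //.
have -> : bilaplacian (fun=> K : R) x = laplacian (fun=> 0 : R) x.
  by apply: (eq_laplacian oA Ax) => y _; rewrite laplacian_cst.
by rewrite laplacian_cst !mulr0 !addr0.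
Qed.

Lemma log_solution_sphere K (x : V) : sphere x -> log_solution K x = - ln (Q x) + K.
Proof.
by move=> /unit_sphereE x1; rewrite /log_solution x1 subrr mul0r mulr0 add0r mulN1r.
Qed.

(** The logarithm contributes - 1 + (1 - c) / Q on the sphere; the bracket in [log_solution],
    including its constant -1, is the function that offsets this. *)
Lemma euler_log_solution K (x : V) : A x -> sphere x -> euler (log_solution K) x = 0.
Proof.
move=> Ax xs.
have cK := smooth_cst K oA.
have s3 := smoothM oA rs hs; have s4 := smoothZ 2^-1 oA s3.
rewrite (eulerD (smoothZ (-1) oA ls) (smoothD oA s4 cK) Ax).
rewrite (eulerD s4 cK Ax) (eulerZ _ oA ls Ax) (eulerZ _ oA s3 Ax) euler_cst.
rewrite (euler_rhoM hs Ax xs) euler_ln_Fsqr // euler_Fsqr powR_inv1 ?(ltW Ax) //.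
move/unit_sphereE: xs => ->.
have : Q x != 0 by rewrite gt_eqF.
by move: (Q x) c => q d q0; field.
Qed.

End Solutions.

(** * The point omega_0 and the closed formulas *)

(** The factor [k] records the relation z = 2 omega_0 / (1 + |omega_0|^2) without dividing by |z|.
    With s = sqrt (1 - |z|^2) one has k = 1 / (1 + s) and |omega_0|^2 = (1 - s) / (1 + s). *)
Lemma omega0_spec (R : realType) (d : nat) (z : 'rV[R]_d) : dotv z z < 1 ->
  exists k, [/\ omega0 z = k *: z, 1 + dotv (omega0 z) (omega0 z) = 2 * k &
                dotv (omega0 z) (omega0 z) < 1].
Proof.
move=> z1; rewrite /omega0; case: eqP => [->|/eqP z0].
  (* For [z = 0] the middle condition forces this value, which is 1 / (1 + s) at s = 1. *)
  exists 2^-1; rewrite scaler0 -[0 : 'rV[R]_d](scale0r z) dotvZl mul0r addr0.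
  by split => //; field.
have zz : 0 < dotv z z.
  by rewrite lt_neqAle dotvv_ge0 andbT eq_sym; apply: contraNneq z0 => /dotvv_eq0 ->.
rewrite enorm_sqr; set s := Num.sqrt _.
have s2 : dotv z z = 1 - s ^+ 2 by rewrite sqr_sqrtr ?subr_ge0 ?(ltW z1) //; ring.
have s0 : 0 < s by rewrite sqrtr_gt0 subr_gt0.
exists ((1 - s) / dotv z z); rewrite dotvZl dotvZr s2.
have s1 : s < 1 by move: zz; rewrite s2 => zz; nra.
have E : (1 - s) / (1 - s ^+ 2) = (1 + s)^-1 by field; apply/andP; split; nra.
rewrite E; split => //.
  by field; lra.
have -> : (1 + s)^-1 * ((1 + s)^-1 * (1 - s ^+ 2)) = (1 - s) / (1 + s) by field; lra.
by rewrite ltr_pdivrMr; lra.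
Qed.

Theorem theorem1p1 (R : realType) (n : nat) (hn : (3 <= n)%N)
    (z0 : 'rV[R]_n.+1) (hz0 : unit_ball z0) :
  let w0 := omega0 z0 in
  [/\ unit_ball w0,
      n = 3%N ->
      forall v : 'rV[R]_n.+1 -> R,
        smooth_on_cball v ->
        (forall xi, unit_ball xi -> bilaplacian v xi = 0) ->
        (forall xi, unit_sphere xi -> normal_derivative v xi = 0) ->
        (forall xi, unit_sphere xi -> v xi = - ln `|1 - dotv z0 xi|) ->
        forall xi, unit_cball xi ->
          v xi = - ln (F xi w0 ^+ 2)
            + (1 - enorm xi ^+ 2) / 2
              * ((1 - enorm w0 ^+ 2) / F xi w0 ^+ 2 - 1)
            + ln (1 + enorm w0 ^+ 2)
    & (3 < n)%N ->
      forall v : 'rV[R]_n.+1 -> R,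
        smooth_on_cball v ->
        (forall xi, unit_ball xi -> bilaplacian v xi = 0) ->
        (forall xi, unit_sphere xi ->
           normal_derivative v xi = - ((n%:R - 3) / 2) * v xi) ->
        (forall xi, unit_sphere xi ->
           v xi = `|1 - dotv z0 xi| `^ ((3 - n%:R) / 2)) ->
        forall xi, unit_cball xi ->
          v xi = (1 + enorm w0 ^+ 2) `^ ((n%:R - 3) / 2) / F xi w0 ^+ (n - 3)
            * (1 + (n%:R - 3) * (1 - enorm w0 ^+ 2) * (1 - enorm xi ^+ 2)
                   / (4 * F xi w0 ^+ 2))].
Proof.
move=> w0; have [k [wz ck w1]] := omega0_spec (proj1 (unit_ballE _) hz0).
rewrite -/w0 in wz ck w1.
have oA := open_Fsqr (w := w0); have cA := cball_Fsqr w1.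
have bA x : unit_ball x -> 0 < Fsqr w0 x by move=> /ball_cball /cA.
have sA x : unit_sphere x -> 0 < Fsqr w0 x.
  by move=> /unit_sphereE x1; apply: cA; apply/unit_cballE; rewrite x1.
have c0 : 0 < 1 + dotv w0 w0 by rewrite ltr_wpDr // dotvv_ge0.
(* This identity motivates the choice of [w0]: on the sphere both sides equal 2k (1 - <z_0, x>). *)
have Qz x : unit_sphere x -> Fsqr w0 x = (1 + dotv w0 w0) * (1 - dotv z0 x).
  move=> /unit_sphereE x1; rewrite /Fsqr x1 wz dotvC dotvZl -wz.
  have -> : dotv w0 w0 = 2 * k - 1 by rewrite -ck; ring.
  by move: (dotv _ _) => t; ring.
have z1 x : unit_sphere x -> 0 < 1 - dotv z0 x.
  by move=> xs; have := sA _ xs; rewrite Qz // pmulr_rgt0.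
split; first exact/unit_ballE.
- move=> n3 v vs bv nv vf x xc.
  pose K := ln (1 + dotv w0 w0).
  have bS y : unit_ball y -> bilaplacian (log_solution w0 K) y = 0.
    by move=> /bA; exact: bilaplacian_log_solution.
  have vS y : unit_sphere y -> v y = log_solution w0 K y.
    move=> ys; rewrite log_solution_sphere // vf // Qz //.
    by rewrite gtr0_norm ?z1 // lnM ?posrE ?z1 // /K; ring.
  have nS y : unit_sphere y -> normal_derivative v y = euler (log_solution w0 K) y.
    by move=> ys; rewrite nv // euler_log_solution //; exact: sA.
  rewrite (clamped_biharmonic_unique oA cA vs (smooth_log_solution w0 K) bv bS vS nS xc).
  rewrite /log_solution !enorm_sqr F_sqr powR_inv1; last exact/ltW/cA.
  rewrite -/K; move: (ln (Fsqr w0 x)) (Fsqr w0 x)^-1 (dotv x x) (dotv w0 w0) => a b d e.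
  by clearbody K; ring.
move=> n3 v vs bv nv vf x xc.
pose K := (1 + dotv w0 w0) `^ ((n%:R - 3) / 2).
have bS y : unit_ball y -> bilaplacian (power_solution w0 K) y = 0.
  by move=> /bA; exact: bilaplacian_power_solution.
have vS y : unit_sphere y -> v y = power_solution w0 K y.
  move=> ys; rewrite power_solution_sphere // vf // Qz // gtr0_norm ?z1 //.
  rewrite powRM ?(ltW c0) ?(ltW (z1 _ ys)) // mulrA -powRD; last first.
    by apply/implyP => _; rewrite gt_eqF.
  have -> : (n%:R - 3) / 2 + (3 - n%:R) / 2 = 0 :> R by field.
  by rewrite powRr0 mul1r.
have nS y : unit_sphere y -> normal_derivative v y = euler (power_solution w0 K) y.
  (* The Robin condition becomes Neumann data once the boundary values of [v] are inserted. *)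
  move=> ys; rewrite nv // vS // power_solution_sphere //.
  by rewrite euler_power_solution //; exact: sA.
rewrite (clamped_biharmonic_unique oA cA vs (smooth_power_solution w0 K) bv bS vS nS xc).
have Qx : 0 < Fsqr w0 x by exact: cA.
have Fx : 0 < F x w0.
  by rewrite lt_neqAle F_ge0 andbT eq_sym -sqrf_eq0 F_sqr gt_eqF.
rewrite /power_solution !enorm_sqr F_sqr.
(* Back from real powers of [F ^+ 2] to the natural power [n - 3] of [F]; the subtraction is not
   truncated because [n] is at least 3. *)
have -> : Fsqr w0 x `^ ((3 - n%:R) / 2) = (F x w0 ^+ (n - 3))^-1.
  rewrite -F_sqr -powR_mulrn ?ltW // -powRrM -powR_invn ?ltW //.
  by rewrite natrB //; congr (_ `^ _); field.
have -> : Fsqr w0 x `^ ((3 - n%:R) / 2 - 1) = (F x w0 ^+ (n - 3))^-1 / Fsqr w0 x.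
  rewrite powRB; last by apply/implyP => _; rewrite gt_eqF.
  rewrite powRr1 ?ltW //; congr (_ / _).
  rewrite -F_sqr -powR_mulrn ?ltW // -powRrM -powR_invn ?ltW //.
  by rewrite natrB //; congr (_ `^ _); field.
have F0 : F x w0 ^+ (n - 3) != 0 by rewrite expf_neq0 // gt_eqF.
move: (F x w0 ^+ (n - 3)) (Fsqr w0 x) (lt0r_neq0 Qx) F0 => f q q0 f0.
by rewrite -/K; clearbody K; field; rewrite q0 f0.
Qed.
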